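(* Let $n\in\mathbb{N}$ and $k,l\in\mathbb{Z}$, and let $E=H_n\rtimes_\psi\mathbb{Z}$, where $\psi\in\mathrm{Aut}(H_n)$ is given by $\psi(x)=x^{-1}z^k$ and $\psi(y)=y^{-1}z^l$. (1) If $n$ is odd, $E$ has Reidemeister spectrum $4\mathbb{N}\cup\{\infty\}$. (2) If $n$ is even, $E$ has Reidemeister spectrum $4\mathbb{N}\cup\{\infty\}$ if both $k$ and $l$ are even, and Reidemeister spectrum $8\mathbb{N}\cup\{\infty\}$ if $k$ or $l$ is odd.
   Context: $\mathbb{N}$ denotes the set of positive integers. $H_n=\langle x,y,z\mid [z,x]=1,\ [z,y]=1,\ [y,x]=z^n\rangle$. For a group $G$ and $\psi\in\mathrm{Aut}(G)$, $G\rtimes_\psi\mathbb{Z}$ denotes the semidirect product in which a generator of $\mathbb{Z}$ acts on $G$ via $\psi$. For a group $G$ and an endomorphism $\varphi$ of $G$, say $g\sim_\varphi h$ if there is $w\in G$ with $g=wh\varphi(w)^{-1}$; the Reidemeister number $R(\varphi)$ is the number of equivalence classes of $\sim_\varphi$ ($\infty$ if infinite). The Reidemeister spectrum of $G$ is $\mathrm{Spec}_R(G)=\{R(\varphi)\mid \varphi\in\mathrm{Aut}(G)\}$. *)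

(* Defs.v *)
From HB Require Import structures.
From mathcomp Require Import all_boot ssralg ssrnum ssrint intdiv finmap.
From mathcomp Require Import boolp classical_sets functions cardinality.

Set Implicit Arguments.
Unset Strict Implicit.
Unset Printing Implicit Defensive.

Local Open Scope group_scope.

(** * Integer powers and automorphisms of (possibly infinite) groups *)

Definition gexpz (G : groupType) (x : G) (k : int) : G :=
  match k with Posz m => x ^+ m | Negz m => x ^- m.+1 end.

(* The inverse is carried along as data so that negative powers of an
   automorphism are available. *)
Record aut (G : groupType) := Aut {
  aut_fun :> {multiplicative G -> G};
  aut_inv : G -> G;
  aut_funK : cancel aut_fun aut_inv;
  aut_invK : cancel aut_inv aut_fun }.

Definition aut_pow (G : groupType) (psi : aut G) (m : int) : G -> G :=
  match m with Posz p => iter p psi | Negz p => iter p.+1 (aut_inv psi) end.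

Section AutPow.
Variables (G : groupType) (psi : aut G).

Lemma aut_invM : {morph aut_inv psi : x y / x * y}.
Proof.
move=> x y; apply: (can_inj (aut_funK psi)).
by rewrite aut_invK gmulfM !aut_invK.
Qed.

Lemma aut_powM m : {morph aut_pow psi m : x y / x * y}.
Proof.
case: m => p x y; first by elim: p => //= p ->; rewrite gmulfM.
by rewrite /aut_pow; elim: p.+1 => //= q ->; rewrite aut_invM.
Qed.

Lemma aut_pow0 x : aut_pow psi 0 x = x. Proof. by []. Qed.

Lemma aut_powS m x : aut_pow psi (m + 1)%R x = psi (aut_pow psi m x).
Proof.
case: m => p; first by rewrite -PoszD addn1.
case: p => [|p]; first by rewrite /= aut_invK.
have -> : (Negz p.+1 + 1)%R = Negz p.
  by rewrite !NegzE -addn1 PoszD GRing.opprD GRing.subrK.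
by rewrite /= aut_invK.
Qed.

Lemma aut_powP m x : aut_pow psi (m - 1)%R x = aut_inv psi (aut_pow psi m x).
Proof. by rewrite -{2}[m](GRing.subrK 1%R) aut_powS aut_funK. Qed.

Lemma aut_powD m p x :
  aut_pow psi (m + p)%R x = aut_pow psi m (aut_pow psi p x).
Proof.
elim/int_rec: m => [|m IH|m IH]; first by rewrite GRing.add0r.
  by rewrite -addn1 PoszD GRing.addrAC !aut_powS IH.
by rewrite -addn1 PoszD GRing.opprD GRing.addrAC !aut_powP IH.
Qed.

End AutPow.

(** * The semidirect product [G x|_psi Z] *)

(* [(g, m)] stands for [g * t^m], where [t * g * t^-1 = psi g]. *)
Definition sdprodZ (G : groupType) (psi : aut G) : Type := (G * int)%type.

Section SdprodZ.
Variables (G : groupType) (psi : aut G).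

HB.instance Definition _ := Choice.copy (sdprodZ psi) (G * int)%type.

Definition sdpZ_mul (a b : sdprodZ psi) : sdprodZ psi :=
  (a.1 * aut_pow psi a.2 b.1, (a.2 + b.2)%R).
Definition sdpZ_one : sdprodZ psi := (1, 0%R).
Definition sdpZ_inv (a : sdprodZ psi) : sdprodZ psi :=
  (aut_pow psi (- a.2)%R a.1^-1, (- a.2)%R).

Lemma sdpZ_mulA : associative sdpZ_mul.
Proof.
by move=> a b c; rewrite /sdpZ_mul /= aut_powM mulgA aut_powD GRing.addrA.
Qed.

Lemma aut_pow1 m : aut_pow psi m 1 = 1.
Proof. by apply: (@mulgI _ (aut_pow psi m 1)); rewrite -aut_powM !mulg1. Qed.

Lemma sdpZ_mul1 : left_id sdpZ_one sdpZ_mul.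
Proof. by case=> g m; rewrite /sdpZ_mul /= mul1g GRing.add0r. Qed.

Lemma sdpZ_mulr1 : right_id sdpZ_one sdpZ_mul.
Proof. by case=> g m; rewrite /sdpZ_mul /= aut_pow1 mulg1 GRing.addr0. Qed.

Lemma sdpZ_mulV : left_inverse sdpZ_one sdpZ_inv sdpZ_mul.
Proof.
by case=> g m; rewrite /sdpZ_mul /= -aut_powM mulVg aut_pow1 GRing.addNr.
Qed.

Lemma sdpZ_mulrV : right_inverse sdpZ_one sdpZ_inv sdpZ_mul.
Proof.
case=> g m; rewrite /sdpZ_mul /= -aut_powD GRing.subrr /=.
by rewrite mulgV.
Qed.

HB.instance Definition _ := isGroup.Build (sdprodZ psi)
  sdpZ_mulA sdpZ_mul1 sdpZ_mulr1 sdpZ_mulV sdpZ_mulrV.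

End SdprodZ.

(** * Groups given by generators and relations *)

(* A letter [(a, true)] is the generator [a], [(a, false)] is its inverse. *)
Definition word (A : choiceType) := seq (A * bool).

Definition winv (A : choiceType) (w : word A) : word A :=
  rev [seq (a.1, ~~ a.2) | a <- w].

(* Same convention as [commg]: u^-1 v^-1 u v. *)
Definition wcomm (A : choiceType) (u v : word A) : word A :=
  winv u ++ winv v ++ u ++ v.

Section Presentation.
Variables (A : choiceType) (rels : seq (word A * word A)).

Inductive pres_eq : word A -> word A -> Prop :=
| pres_refl u : pres_eq u u
| pres_sym u v : pres_eq u v -> pres_eq v u
| pres_trans u v w : pres_eq u v -> pres_eq v w -> pres_eq u w
| pres_cat u u' v v' :
    pres_eq u u' -> pres_eq v v' -> pres_eq (u ++ v) (u' ++ v')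
| pres_cancel a b : pres_eq [:: (a, b); (a, ~~ b)] [::]
| pres_rel r : r \in rels -> pres_eq r.1 r.2.

Definition pres_eqb (u v : word A) : bool := `[< pres_eq u v >].

Lemma pres_eqb_refl : reflexive pres_eqb.
Proof. by move=> u; apply/asboolP; apply: pres_refl. Qed.

Lemma pres_eqb_sym : symmetric pres_eqb.
Proof. by move=> u v; apply/asboolP/asboolP; apply: pres_sym. Qed.

Lemma pres_eqb_trans : transitive pres_eqb.
Proof.
by move=> v u w /asboolP uv /asboolP vw; apply/asboolP; apply: pres_trans uv vw.
Qed.

Canonical pres_equiv :=
  EquivRel pres_eqb pres_eqb_refl pres_eqb_sym pres_eqb_trans.

Definition pres_group := {eq_quot pres_equiv}%qT.
HB.instance Definition _ := Choice.on pres_group.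
HB.instance Definition _ := EqQuotient.on pres_group.

Definition pres_class (w : word A) : pres_group := (\pi_pres_group w)%qT.
Definition pres_gen (a : A) : pres_group := pres_class [:: (a, true)].

Lemma pres_classP u v : pres_class u = pres_class v <-> pres_eq u v.
Proof.
split=> [/eqP|uv]; first by rewrite piE => /asboolP.
by apply/eqP; rewrite piE; apply/asboolP.
Qed.

Lemma pres_reprK (g : pres_group) : pres_class (repr g) = g.
Proof. exact: reprK. Qed.

Lemma pres_ind (P : pres_group -> Prop) :
  (forall w, P (pres_class w)) -> forall g, P g.
Proof. by move=> PW g; rewrite -[g]pres_reprK. Qed.

Lemma winv_r w : pres_eq (w ++ winv w) [::].
Proof.
elim: w => [|[a b] w IH]; first exact: pres_refl.
rewrite /winv /= rev_cons -cats1 catA.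
apply: pres_trans (pres_cancel a b).
rewrite -/(winv w).
have h := pres_cat (pres_refl [:: (a, b)])
  (pres_cat IH (pres_refl [:: (a, ~~ b)])).
by rewrite /= -catA in h *.
Qed.

Lemma winvK : involutive (@winv A).
Proof.
move=> w; rewrite /winv map_rev revK -map_comp -[RHS]map_id.
by apply: eq_map => -[a b] /=; rewrite negbK.
Qed.

Lemma winv_l w : pres_eq (winv w ++ w) [::].
Proof. by rewrite -{2}[w]winvK; apply: winv_r. Qed.

Lemma winv_eq u v : pres_eq u v -> pres_eq (winv u) (winv v).
Proof.
move=> uv; apply: (@pres_trans _ (winv u ++ (v ++ winv v))).
  rewrite -[X in pres_eq X]cats0; apply: pres_cat (pres_refl _) _.
  exact/pres_sym/winv_r.
rewrite catA -[X in pres_eq _ X]cat0s; apply: pres_cat (pres_refl _).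
apply: pres_trans (winv_l u); apply: pres_cat (pres_refl _) _.
exact: pres_sym.
Qed.

Definition pres_mul (g h : pres_group) := pres_class (repr g ++ repr h).
Definition pres_one := pres_class [::].
Definition pres_inv (g : pres_group) := pres_class (winv (repr g)).

Lemma pres_repr w : pres_eq (repr (pres_class w)) w.
Proof. by apply/pres_classP; rewrite pres_reprK. Qed.

Lemma pres_mulE u v :
  pres_mul (pres_class u) (pres_class v) = pres_class (u ++ v).
Proof. by apply/pres_classP; apply: pres_cat; apply: pres_repr. Qed.

Lemma pres_invE u : pres_inv (pres_class u) = pres_class (winv u).
Proof. by apply/pres_classP; apply/winv_eq/pres_repr. Qed.

Lemma pres_mulA : associative pres_mul.
Proof.
by elim/pres_ind=> u; elim/pres_ind=> v; elim/pres_ind=> w;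
  rewrite !pres_mulE catA.
Qed.

Lemma pres_mul1 : left_id pres_one pres_mul.
Proof. by elim/pres_ind=> u; rewrite pres_mulE. Qed.

Lemma pres_mulr1 : right_id pres_one pres_mul.
Proof. by elim/pres_ind=> u; rewrite pres_mulE cats0. Qed.

Lemma pres_mulV : left_inverse pres_one pres_inv pres_mul.
Proof.
elim/pres_ind=> u; rewrite pres_invE pres_mulE.
exact/pres_classP/winv_l.
Qed.

Lemma pres_mulrV : right_inverse pres_one pres_inv pres_mul.
Proof.
elim/pres_ind=> u; rewrite pres_invE pres_mulE.
exact/pres_classP/winv_r.
Qed.

HB.instance Definition _ := isGroup.Build pres_group
  pres_mulA pres_mul1 pres_mulr1 pres_mulV pres_mulrV.

Lemma pres_classM u v : pres_class (u ++ v) = pres_class u * pres_class v.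
Proof. by rewrite -pres_mulE. Qed.

Lemma pres_classV u : pres_class (winv u) = (pres_class u)^-1.
Proof. by rewrite -pres_invE. Qed.

Lemma pres_classR u v :
  pres_class (wcomm u v) = [~ pres_class u, pres_class v].
Proof. by rewrite !pres_classM !pres_classV. Qed.

Lemma pres_classX a m :
  pres_class (nseq m (a, true)) = pres_gen a ^+ m.
Proof.
by elim: m => [|m IH] //; rewrite expgS -IH -pres_classM.
Qed.

(* Von Dyck's theorem *)
Section Lift.
Variables (K : groupType) (f : A -> K).

Definition weval (w : word A) : K :=
  \prod_(a <- w) (if a.2 then f a.1 else (f a.1)^-1).

Hypothesis f_rels : forall r, r \in rels -> weval r.1 = weval r.2.

Lemma weval_cat u v : weval (u ++ v) = weval u * weval v.
Proof. exact: big_cat. Qed.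

Lemma weval_eq u v : pres_eq u v -> weval u = weval v.
Proof.
elim=> {u v} //.
- by move=> u v w _ -> _ ->.
- by move=> u u' v v' _ eu _ ev; rewrite !weval_cat eu ev.
by move=> a [] ; rewrite /weval !big_cons big_nil /= mulg1 ?mulgV ?mulVg.
Qed.

Definition pres_lift (g : pres_group) : K := weval (repr g).

Lemma pres_lift_class w : pres_lift (pres_class w) = weval w.
Proof. exact/weval_eq/pres_repr. Qed.

Lemma pres_liftM : {morph pres_lift : g h / g * h}.
Proof.
elim/pres_ind=> u; elim/pres_ind=> v.
by rewrite -pres_classM !pres_lift_class weval_cat.
Qed.

Lemma pres_lift_gen a : pres_lift (pres_gen a) = f a.
Proof. by rewrite pres_lift_class /weval big_seq1. Qed.

End Lift.

Lemma pres_hom_ext (K : groupType) (f g : pres_group -> K) :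
    {morph f : x y / x * y} -> {morph g : x y / x * y} ->
  (forall a, f (pres_gen a) = g (pres_gen a)) -> f =1 g.
Proof.
move=> fM gM fg.
have h1 (h : pres_group -> K) : {morph h : x y / x * y} -> h 1 = 1.
  by move=> hM; apply: (@mulgI _ (h 1)); rewrite -hM !mulg1.
have hV (h : pres_group -> K) x :
    {morph h : x y / x * y} -> h x^-1 = (h x)^-1.
  by move=> hM; apply: (@mulgI _ (h x)); rewrite -hM !mulgV h1.
elim/pres_ind; elim=> [|[a b] w IH]; first by rewrite (h1 f) ?(h1 g).
rewrite -cat1s pres_classM fM gM IH; congr (_ * _).
case: b; first exact: fg.
have -> : pres_class [:: (a, false)] = (pres_gen a)^-1 by rewrite -pres_classV.
by rewrite !hV // fg.
Qed.

End Presentation.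

(** * The groups [H_n] *)

(* The letters x, y, z are the elements 0, 1, 2 of ['I_3]. *)
Definition wx : word 'I_3 := [:: (inord 0, true)].
Definition wy : word 'I_3 := [:: (inord 1, true)].
Definition wz : word 'I_3 := [:: (inord 2, true)].

Definition heis_rels (n : nat) : seq (word 'I_3 * word 'I_3) :=
  [:: (wcomm wz wx, [::]);
      (wcomm wz wy, [::]);
      (wcomm wy wx, nseq n (inord 2, true)) ].

Definition heis (n : nat) := pres_group (heis_rels n).
HB.instance Definition _ n := Group.on (heis n).

Definition heis_x n : heis n := pres_gen (heis_rels n) (inord 0).
Definition heis_y n : heis n := pres_gen (heis_rels n) (inord 1).
Definition heis_z n : heis n := pres_gen (heis_rels n) (inord 2).

Lemma heis_relP n :
  [/\ [~ heis_z n, heis_x n] = 1, [~ heis_z n, heis_y n] = 1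
    & [~ heis_y n, heis_x n] = heis_z n ^+ n].
Proof.
have cl u v : (u, v) \in heis_rels n ->
    pres_class (heis_rels n) u = pres_class (heis_rels n) v.
  by move=> uv; apply/pres_classP; apply: (pres_rel uv).
split.
- by rewrite -pres_classR (cl _ [::]) // inE eqxx.
- by rewrite -pres_classR (cl _ [::]) // !inE eqxx orbT.
by rewrite -pres_classX -pres_classR (cl _ (nseq n (inord 2, true))) // !inE eqxx !orbT.
Qed.

Lemma gexpz_commute (G : groupType) (x y : G) k :
  commute x y -> commute x (gexpz y k).
Proof.
by case: k => m cxy; [apply: commuteX | apply/commuteV/commuteX].
Qed.

Lemma gexpz_morph (G K : groupType) (f : G -> K) x k :
  {morph f : x y / x * y} -> f (gexpz x k) = gexpz (f x) k.
Proof.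
move=> fM.
have f1 : f 1 = 1 by apply: (@mulgI _ (f 1)); rewrite -fM !mulg1.
have fV u : f u^-1 = (f u)^-1.
  by apply: (@mulgI _ (f u)); rewrite -fM !mulgV.
have fX m : f (x ^+ m) = f x ^+ m.
  by elim: m => // m IH; rewrite !expgS fM IH.
by case: k => m /=; rewrite ?fV fX.
Qed.

(* The assignment x |-> x^-1 z^k, y |-> y^-1 z^l extends to an automorphism. *)
Lemma heis_aut_exists n (k l : int) :
  exists psi : aut (heis n),
    psi (heis_x n) = (heis_x n)^-1 * gexpz (heis_z n) k /\
    psi (heis_y n) = (heis_y n)^-1 * gexpz (heis_z n) l.
Proof.
set x := heis_x n; set y := heis_y n; set z := heis_z n.
have [/eqP/commgP zx /eqP/commgP zy yx] := heis_relP n.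
have zzk m : commute z (gexpz z m) by apply: gexpz_commute.
pose x' := x^-1 * gexpz z k; pose y' := y^-1 * gexpz z l.
have i01 : (inord 1 == inord 0 :> 'I_3) = false 
    by apply/eqP => /(congr1 (@nat_of_ord 3)); rewrite !inordK.
have i20 : (inord 2 == inord 0 :> 'I_3) = false 
    by apply/eqP => /(congr1 (@nat_of_ord 3)); rewrite !inordK.
have i21 : (inord 2 == inord 1 :> 'I_3) = false 
    by apply/eqP => /(congr1 (@nat_of_ord 3)); rewrite !inordK.
pose f (i : 'I_3) : heis n :=
  if i == inord 0 then x' else if i == inord 1 then y' else z.
have f0 : f (inord 0) = x' by rewrite /f eqxx.
have f1 : f (inord 1) = y' by rewrite /f i01 eqxx.
have f2 : f (inord 2) = z by rewrite /f i20 i21.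
have cM (a b c : heis n) : commute a b -> commute a c -> commute a (b * c).
  by move=> ab ac; rewrite /commute mulgA ab -mulgA ac mulgA.
have zx' : commute z x' by apply: cM; [exact: commuteV | exact: zzk].
have zy' : commute z y' by apply: cM; [exact: commuteV | exact: zzk].
have evR u v : weval f (wcomm u v) = [~ weval f u, weval f v].
  have eV w : weval f (winv w) = (weval f w)^-1.
    apply: (@mulgI _ (weval f w)); rewrite -weval_cat mulgV.
    by rewrite (@weval_eq _ [::] _ f _ _ _ (winv_r _ _)) // /weval big_nil.
  by rewrite !weval_cat !eV.
have ev1 i : weval f [:: (i, true)] = f i by rewrite /weval big_seq1.
have evX m : weval f (nseq m (inord 2, true)) = z ^+ m.
  by elim: m => [|m IH]; rewrite /weval ?big_nil // big_cons expgS -IH /= f2.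
have xzl : commute x (gexpz z l) by apply: gexpz_commute; apply: commute_sym.
have yzk : commute y (gexpz z k) by apply: gexpz_commute; apply: commute_sym.
have key : [~ y', x'] = z ^+ n.
  apply: (@mulgI _ (x' * y')); rewrite -commgC.
  have zn (u : heis n) : commute z u -> z ^+ n * u = u * z ^+ n.
    by move=> zu; apply/commute_sym/commuteX/commute_sym.
  rewrite -zn; last exact: cM.
  have xd u m : commute u (gexpz z m) -> gexpz z m * u^-1 = u^-1 * gexpz z m.
    by move=> c; exact: commuteV (commute_sym c).
  have kl : commute (gexpz z k) (gexpz z l).
    by apply: gexpz_commute; apply: commute_sym.
  have -> : y' * x' = y^-1 * x^-1 * (gexpz z l * gexpz z k).
    by rewrite -!mulgA; congr (_ * _); rewrite !mulgA xd.
  have -> : x' * y' = x^-1 * y^-1 * (gexpz z l * gexpz z k).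
    by rewrite -kl -!mulgA; congr (_ * _); rewrite !mulgA xd.
  rewrite [RHS]mulgA; congr (_ * _).
  have -> : x^-1 * y^-1 = (x * y * z ^+ n)^-1 by rewrite -yx -commgC invgM.
  by rewrite (invgM (x * y)) mulVKg invgM.
have fr r : r \in heis_rels n -> weval f r.1 = weval f r.2.
  rewrite !inE => /or3P[] /eqP -> /=; rewrite evR !ev1 ?f0 ?f1 ?f2.
  - by rewrite /weval big_nil; apply/eqP/commgP.
  - by rewrite /weval big_nil; apply/eqP/commgP.
  by rewrite evX.
pose p : heis n -> heis n := @pres_lift _ _ _ f.
have pM : {morph p : g h / g * h} := pres_liftM fr.
have px : p x = x' by rewrite /p pres_lift_gen.
have py : p y = y' by rewrite /p pres_lift_gen.
have pz : p z = z by rewrite /p pres_lift_gen.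
have p1 : p 1 = 1 by apply: (@mulgI _ (p 1)); rewrite -pM !mulg1.
have pV u : p u^-1 = (p u)^-1.
  by apply: (@mulgI _ (p u)); rewrite -pM !mulgV.
have pK : cancel p p.
  apply: (@pres_hom_ext _ (heis_rels n) (heis n) (p \o p) id) => //.
    by move=> u v /=; rewrite !pM.
  have pp u m : p u = u^-1 * gexpz z m -> commute u (gexpz z m) ->
     p (p u) = u.
    move=> pu cu; rewrite pu pM pV pu gexpz_morph // pz invgM invgK.
    by rewrite -mulgA cu mulKg.
  move=> i /=.
  have : i \in [:: inord 0; inord 1; inord 2].
    by rewrite !inE -!val_eqE /= !inordK //; case: i => -[|[|[|]]].
  rewrite !inE => /or3P[] /eqP ->.
  - by apply: (pp _ k) => //; apply: gexpz_commute; apply: commute_sym.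
  - by apply: (pp _ l) => //; apply: gexpz_commute; apply: commute_sym.
  by rewrite -/(heis_z n) !pz.
pose pm := HB.pack_for {multiplicative heis n -> heis n} p
  (isMultiplicative.Build _ _ p pM).
by exists (@Aut _ pm p pK pK).
Qed.

(** * Reidemeister numbers *)

(* [g] and [h] are phi-conjugate *)
Definition rconj (G : groupType) (phi : G -> G) (g h : G) : Prop :=
  exists w : G, g = w * h * (phi w)^-1.

Local Open Scope classical_set_scope.

Definition reidemeister_classes (G : groupType) (phi : G -> G) :
  set (set G) := range (fun g : G => [set h | rconj phi g h]).

(* [Some m] is the finite value [m], [None] is infinity. *)
Definition reidemeister (G : groupType) (phi : G -> G) : option nat :=
  if `[< finite_set (reidemeister_classes phi) >]
  then Some #|` fset_set (reidemeister_classes phi)|%fset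
  else None.

Definition reidemeister_spectrum (G : groupType) : set (option nat) :=
  range (fun phi : aut G => reidemeister phi).

(* a N U {oo}, where N is the set of positive integers *)
Definition multiples_oo (a : nat) : set (option nat) :=
  [set Some (a * m)%N | m in [set m | (0 < m)%N]] `|` [set None].

(* Main.v *)
(* In coordinates, an automorphism [phi] of [E] preserves [H_n] (its elements have
   a power in the commutator subgroup), acts on [H_n / <z> = Z^2] by a matrix [M]
   of determinant [+-1], on [z] by [det M] and on [E / H_n = Z] by [+-1]. The
   Reidemeister number is infinite unless [t] is inverted, [det M = -1] and
   [tr M <> 0]; then the cosets of [H_n] of degree 0 and 1 contribute
   [2 |det (1 - M)|] and [2 |det (1 + M)|], that is [4 |tr M|] in total. The
   relations [t x t^-1 = x^-1 z^k] and [t y t^-1 = y^-1 z^l] restrict [M] only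
   modulo 2, and when [n] is even they require [(k, l) M = (k, l)] modulo 2; for
   [(k, l) <> 0] this forces [tr M] to be even. *)
Require Import Defs.
From HB Require Import structures.
From mathcomp Require Import all_boot ssralg ssrnum ssrint intdiv finmap.
From mathcomp Require Import boolp classical_sets functions cardinality.
From mathcomp Require Import zify ring.

Set Implicit Arguments.
Unset Strict Implicit.
Unset Printing Implicit Defensive.

Local Open Scope group_scope.

(** Equality in a presented group cannot be computed, so the argument is moved to quadruples of
    integers, where the relations become polynomial identities in [psign m] and [parity m]. The
    factor 2 in each contribution comes from [z]: as [phi] inverts it, twisted conjugation by [z^d]
    adds [2 d] to the exponent of [z], and every class modulo [<z>] splits in two. The coset of
    degree 1 involves [1 + M] because [t] acts on [Z^2] as [-1]. For [det M = -1] one has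
    [det (1 - M) = - tr M] and [det (1 + M) = tr M], whence a single condition on the trace. Trace 0
    makes [1 - M] singular, so one family of matrices supplies both the finite values and
    infinity. *)

Lemma int_step_ind (P : int -> Prop) :
  P 0%R -> (forall i, P i <-> P (i + 1)%R) -> forall i, P i.
Proof.
move=> P0 PS; elim/int_rec=> // m IH.
  by rewrite -addn1 PoszD; apply: (PS m).1.
by apply: (PS _).2; rewrite -addn1 PoszD GRing.opprD GRing.subrK.
Qed.

Lemma morph1 (G K : groupType) (f : G -> K) :
  {morph f : g h / g * h} -> f 1 = 1.
Proof. by move=> fM; apply: (@mulgI _ (f 1)); rewrite -fM !mulg1. Qed.

Lemma morphV (G K : groupType) (f : G -> K) g :
  {morph f : g h / g * h} -> f g^-1 = (f g)^-1.
Proof.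
by move=> fM; apply: (@mulgI _ (f g)); rewrite -fM !mulgV morph1.
Qed.

Lemma autM (G : groupType) (phi : aut G) : {morph phi : g h / g * h}.
Proof. exact: gmulfM. Qed.

(** * Integer powers in a group *)

Section GroupPowers.
Variable G : groupType.
Implicit Types (x y z u : G) (i j : int).

Lemma gexpz0 x : gexpz x 0 = 1. Proof. by []. Qed.

Lemma gexpz1 x : gexpz x 1 = x. Proof. by []. Qed.

Lemma gexpzS x i : gexpz x (i + 1)%R = gexpz x i * x.
Proof.
case: i => p; first by rewrite -PoszD addn1 /= expgSr.
case: p => [|p]; first by rewrite /= mulVg.
have -> : (Negz p.+1 + 1)%R = Negz p by lia.
by rewrite /= [x ^+ p.+2]expgS invgM mulgVK.
Qed.

(** Right multiplication by [x] is cancellable, so the recurrence determines [f] in both directions.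
    Closed forms of powers then need no split on the sign of the exponent. *)
Lemma gexpz_unique x (f : int -> G) :
  f 0%R = 1 -> (forall i, f (i + 1)%R = f i * x) -> forall i, gexpz x i = f i.
Proof.
move=> f0 fS; apply: int_step_ind => [|i]; first by rewrite f0.
rewrite gexpzS fS; split=> [-> //|]; exact: mulIg.
Qed.

Lemma gexpzD x i j : gexpz x (i + j)%R = gexpz x i * gexpz x j.
Proof.
suff: gexpz x j = (gexpz x i)^-1 * gexpz x (i + j)%R by move->; rewrite mulVKg.
apply: (gexpz_unique (f := fun j => (gexpz x i)^-1 * gexpz x (i + j)%R)).
  by rewrite GRing.addr0 mulVg.
by move=> h; rewrite GRing.addrA gexpzS mulgA.
Qed.

Lemma gexpzN x i : gexpz x (- i)%R = (gexpz x i)^-1.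
Proof. by apply/(@mulgI _ (gexpz x i)); rewrite -gexpzD GRing.subrr mulgV. Qed.

Lemma gexpz_commute2 x y i j :
  commute x y -> commute (gexpz x i) (gexpz y j).
Proof.
by move=> xy; apply/gexpz_commute/commute_sym/gexpz_commute/commute_sym.
Qed.

Lemma gexpzMl x y i :
  commute x y -> gexpz (x * y) i = gexpz x i * gexpz y i.
Proof.
move=> xy; apply: (gexpz_unique (f := fun i => gexpz x i * gexpz y i)) => [|j].
  by rewrite !gexpz0 mulg1.
rewrite !gexpzS -!mulgA; congr (_ * _); rewrite !mulgA; congr (_ * _).
exact: gexpz_commute.
Qed.

Lemma gexpzM x i j : gexpz x (i * j)%R = gexpz (gexpz x i) j.
Proof.
apply/esym/(gexpz_unique (f := fun j => gexpz x (i * j)%R)) => [|h].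
  by rewrite GRing.mulr0.
by rewrite GRing.mulrDr GRing.mulr1 gexpzD.
Qed.

Lemma gexpzJ x y i : gexpz x i ^ y = gexpz (x ^ y) i.
Proof.
by apply: (gexpz_morph (f := fun u => u ^ y)) => u v; rewrite conjMg.
Qed.

End GroupPowers.

(** * Parities and signs of integers *)

Definition oddz (m : int) : bool := odd `|m|%N.
(** An integer rather than a boolean, so that [psign m], which is [(-1)^m], is polynomial in it and
    identities can be left to [ring]. *)
Definition parity (m : int) : int := (oddz m : nat)%:Z%R.
Definition psign (m : int) : int := (1 - 2 * parity m)%R.

Lemma oddzD i j : oddz (i + j)%R = oddz i (+) oddz j.
Proof. by rewrite /oddz; lia. Qed.

Lemma oddzN i : oddz (- i)%R = oddz i.
Proof. by rewrite /oddz abszN. Qed.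

Lemma oddzM i j : oddz (i * j)%R = oddz i && oddz j.
Proof. by rewrite /oddz abszM oddM. Qed.

Lemma parityD i j :
  parity (i + j)%R = (parity i + parity j - 2 * (parity i * parity j))%R.
Proof. by rewrite /parity oddzD; case: oddz; case: oddz. Qed.

Lemma parityN i : parity (- i)%R = parity i.
Proof. by rewrite /parity oddzN. Qed.

Lemma psignD i j : psign (i + j)%R = (psign i * psign j)%R.
Proof. by rewrite /psign parityD; ring. Qed.

Lemma psignN i : psign (- i)%R = psign i.
Proof. by rewrite /psign parityN. Qed.

Ltac hz_ring := congr (_, _, _, _)%R; rewrite /psign /parity /=; ring.

(** * A coordinate model of [E] *)

(* [(a, b, c, m)] stands for [x^a y^b z^c t^m]. *)
Definition hz (n : nat) (k l : int) : Type := (int * int * int * int)%type.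

Section Coordinates.
Variables (n : nat) (k l : int).
Local Notation K := (hz n k l).

HB.instance Definition _ := Choice.copy K (int * int * int * int)%type.

(** Moving [t^m] to the right past [x^a' y^b'] multiplies both exponents by [psign m] and, since
    [psi^2 = 1], releases [z^(k a' + l b')] only for odd [m]. Moving [y^b] past the new power of [x]
    gives the term with [n]. *)
Definition hz_mul (g h : K) : K :=
  let: (a, b, c, m) := g in let: (a', b', c', m') := h in
  (a + psign m * a', b + psign m * b',
   c + c' + parity m * (k * a' + l * b') + n%:Z * b * (psign m * a'), m + m')%R.

Definition hz_one : K := (0, 0, 0, 0)%R.

Definition hz_inv (g : K) : K :=
  let: (a, b, c, m) := g in
  (- (psign m * a), - (psign m * b),
   n%:Z * a * b - c - parity m * (k * a + l * b), - m)%R.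

Lemma hz_mulA : associative hz_mul.
Proof.
move=> [[[a b] c] m] [[[a' b'] c'] m'] [[[a'' b''] c''] m''] /=.
rewrite psignD parityD /psign /parity.
by case: (oddz m); case: (oddz m') => /=; congr (_, _, _, _)%R; ring.
Qed.

Lemma hz_mul1 : left_id hz_one hz_mul.
Proof. by move=> [[[a b] c] m] /=; hz_ring. Qed.

Lemma hz_mulr1 : right_id hz_one hz_mul.
Proof. by move=> [[[a b] c] m] /=; congr (_, _, _, _)%R; ring. Qed.

Lemma hz_mulV : left_inverse hz_one hz_inv hz_mul.
Proof.
move=> [[[a b] c] m]; rewrite /hz_mul /hz_inv psignN parityN /psign /parity.
by case: (oddz m) => /=; congr (_, _, _, _)%R; ring.
Qed.

Lemma hz_mulrV : right_inverse hz_one hz_inv hz_mul.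
Proof.
move=> [[[a b] c] m]; rewrite /hz_mul /hz_inv /psign /parity.
by case: (oddz m) => /=; congr (_, _, _, _)%R; ring.
Qed.

HB.instance Definition _ := isGroup.Build K
  hz_mulA hz_mul1 hz_mulr1 hz_mulV hz_mulrV.

Lemma hz_mulE a b c m a' b' c' m' :
  ((a, b, c, m) : K) * ((a', b', c', m') : K) =
  (a + psign m * a', b + psign m * b',
   c + c' + parity m * (k * a' + l * b') + n%:Z * b * (psign m * a'), m + m')%R.
Proof. by []. Qed.

Definition gen_x : K := (1, 0, 0, 0)%R.
Definition gen_y : K := (0, 1, 0, 0)%R.
Definition gen_z : K := (0, 0, 1, 0)%R.
Definition gen_t : K := (0, 0, 0, 1)%R.

Lemma gexpz_x i : gexpz gen_x i = (i, 0, 0, 0)%R.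
Proof.
apply: (gexpz_unique (f := fun j => (j, 0, 0, 0)%R : K)) => // j.
by rewrite hz_mulE; hz_ring.
Qed.

Lemma gexpz_y i : gexpz gen_y i = (0, i, 0, 0)%R.
Proof.
apply: (gexpz_unique (f := fun j => (0, j, 0, 0)%R : K)) => // j.
by rewrite hz_mulE; hz_ring.
Qed.

Lemma gexpz_z i : gexpz gen_z i = (0, 0, i, 0)%R.
Proof.
apply: (gexpz_unique (f := fun j => (0, 0, j, 0)%R : K)) => // j.
by rewrite hz_mulE; hz_ring.
Qed.

Lemma gexpz_t i : gexpz gen_t i = (0, 0, 0, i)%R.
Proof.
apply: (gexpz_unique (f := fun j => (0, 0, 0, j)%R : K)) => // j.
by rewrite hz_mulE; hz_ring.
Qed.

End Coordinates.

(** * Homomorphisms out of the model *)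

Section UniversalProperty.
Variables (n : nat) (k l : int) (G : groupType) (X Y Z T : G).

Definition normal_form (g : hz n k l) : G :=
  let: (a, b, c, m) := g in
  gexpz X a * gexpz Y b * gexpz Z c * gexpz T m.

Hypothesis ZX : commute Z X.
Hypothesis ZY : commute Z Y.
Hypothesis YX : Y * X = X * Y * gexpz Z n.

(** Conjugation commutes with powers: [Y^X = Y Z^n] gives the conjugate of [Y^b] by [X], hence that
    of [X] by [Y^-b], which is then raised to the power [a]. *)
Lemma gexpz_heis a b :
  gexpz Y b * gexpz X a = gexpz X a * gexpz Y b * gexpz Z (n%:Z * b * a)%R.
Proof.
have YbX : gexpz Y b * X = X * gexpz Y b * gexpz Z (n%:Z * b)%R.
  apply: (@mulgI _ X^-1); rewrite -[LHS]/(gexpz Y b ^ X) gexpzJ -mulgA mulKg.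
  rewrite gexpzM -gexpzMl; last exact/gexpz_commute/commute_sym.
  by rewrite /conjg YX -mulgA mulKg.
have YZ i : commute (gexpz Y b) (gexpz Z i).
  exact/gexpz_commute2/commute_sym.
have XJ : X ^ (gexpz Y b)^-1 = X * gexpz Z (n%:Z * b)%R.
  by rewrite /conjg invgK mulgA YbX -[X * _ * _]mulgA YZ mulgA mulgK.
apply: (@mulIg _ (gexpz Y b)^-1).
rewrite -[gexpz X a * _ * _]mulgA YZ mulgA mulgK.
rewrite [LHS](_ : _ = gexpz X a ^ (gexpz Y b)^-1); last first.
  by rewrite /conjg invgK mulgA.
rewrite gexpzJ XJ gexpzMl; last exact/gexpz_commute/commute_sym.
by rewrite -gexpzM.
Qed.

Hypothesis ZT : commute Z T.
Hypothesis TX : T * X = X^-1 * gexpz Z k * T.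
Hypothesis TY : T * Y = Y^-1 * gexpz Z l * T.

(** The conjugates [V i] of [U] by powers of [T] satisfy [V (i + 1) = (V i)^-1 Z^h], because [Z]
    commutes with [T]. They alternate between [U] and [U^-1 Z^h]. *)
Lemma gexpz_twist (U : G) (h a m : int) :
  commute Z U -> T * U = U^-1 * gexpz Z h * T ->
  gexpz T m * gexpz U a =
    gexpz U (psign m * a)%R * gexpz Z (parity m * h * a)%R * gexpz T m.
Proof.
move=> ZU TU.
have ZTi i j : commute (gexpz Z i) (gexpz T j) by apply: gexpz_commute2.
have ZUi i j : commute (gexpz Z i) (gexpz U j) by apply: gexpz_commute2.
pose V i := gexpz T i * U / gexpz T i.
have VS i : V (i + 1)%R = (V i)^-1 * gexpz Z h.
  rewrite /V gexpzS !invgM invgK !mulgA -[_ * T * U]mulgA TU !mulgA mulgK.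
  by rewrite -!mulgA (commuteV (ZTi h i)).
have VE i : V i = gexpz U (psign i) * gexpz Z (parity i * h)%R.
  move: i; apply: int_step_ind => [|i].
    by rewrite /V !gexpz0 mul1g invg1 mulg1 GRing.mul0r gexpz0 mulg1.
  have WS : gexpz U (psign (i + 1)) * gexpz Z (parity (i + 1) * h)%R =
      (gexpz U (psign i) * gexpz Z (parity i * h)%R)^-1 * gexpz Z h.
    rewrite invgM -!gexpzN ZUi -mulgA -gexpzD psignD parityD.
    by congr (gexpz U _ * gexpz Z _); rewrite /psign /parity /=; ring.
  by rewrite VS WS; split=> [-> //|/mulIg/invg_inj].
apply: (@mulIg _ (gexpz T m)^-1); rewrite mulgK.
rewrite [LHS](_ : _ = gexpz U a ^ (gexpz T m)^-1); last first.
  by rewrite /conjg invgK mulgA.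
rewrite gexpzJ [U ^ _](_ : _ = V m); last by rewrite /conjg invgK mulgA.
by rewrite VE gexpzMl -?gexpzM //; apply/commute_sym.
Qed.

(** The counterpart of von Dyck's theorem for the model. It serves twice: for the isomorphism onto
    the semidirect product, and to build automorphisms of the model. *)
Lemma normal_formM : {morph normal_form : g h / g * h}.
Proof.
move=> [[[a b] c] m] [[[a' b'] c'] m']; rewrite hz_mulE /normal_form.
set e := psign m; set p := parity m.
have cZX i j : gexpz Z i * gexpz X j = gexpz X j * gexpz Z i.
  exact: gexpz_commute2.
have cZY i j : gexpz Z i * gexpz Y j = gexpz Y j * gexpz Z i.
  exact: gexpz_commute2.
have cTZ i j : gexpz T i * gexpz Z j = gexpz Z j * gexpz T i.
  exact/gexpz_commute2/commute_sym.
symmetry.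
rewrite !mulgA -[_ * gexpz T m * _]mulgA (gexpz_twist _ _ ZX TX) -/e -/p.
rewrite !mulgA -[_ * gexpz T m * _]mulgA (gexpz_twist _ _ ZY TY) -/e -/p.
rewrite !mulgA -[_ * gexpz T m * _]mulgA cTZ !mulgA -[_ * gexpz T m * _]mulgA.
rewrite -gexpzD.
rewrite -[_ * gexpz Z c * _]mulgA cZX !mulgA.
rewrite -[_ * gexpz Y b * _]mulgA gexpz_heis !mulgA -gexpzD.
rewrite -!mulgA (mulgA (gexpz Z _) (gexpz Z _)) -gexpzD.
rewrite (mulgA (gexpz Z _) (gexpz Z _)) -gexpzD.
rewrite (mulgA (gexpz Z _) (gexpz Y _)) cZY.
rewrite -!mulgA (mulgA (gexpz Z _) (gexpz Z _)) -gexpzD.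
rewrite (mulgA (gexpz Z _) (gexpz Z _)) -gexpzD.
rewrite (mulgA (gexpz Y _) (gexpz Y _)) -gexpzD.
by congr (_ * (_ * (gexpz Z _ * _))); ring.
Qed.

End UniversalProperty.

Section Generators.
Variables (n : nat) (k l : int).
Local Notation K := (hz n k l).
Local Notation x := (gen_x n k l).
Local Notation y := (gen_y n k l).
Local Notation z := (gen_z n k l).
Local Notation t := (gen_t n k l).

Lemma gen_zx : commute z x.
Proof. by rewrite /commute !hz_mulE; hz_ring. Qed.

Lemma gen_zy : commute z y.
Proof. by rewrite /commute !hz_mulE; hz_ring. Qed.

Lemma gen_yx : y * x = x * y * gexpz z n.
Proof. by rewrite gexpz_z !hz_mulE; hz_ring. Qed.

Lemma gen_tx : t * x = x^-1 * gexpz z k * t.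
Proof. by rewrite gexpz_z -[x^-1]/(gexpz x (-1)) gexpz_x !hz_mulE; hz_ring. Qed.

Lemma gen_ty : t * y = y^-1 * gexpz z l * t.
Proof. by rewrite gexpz_z -[y^-1]/(gexpz y (-1)) gexpz_y !hz_mulE; hz_ring. Qed.

Lemma hz_normal_form g : normal_form x y z t g = g.
Proof.
case: g => [[[a b] c] m].
by rewrite /normal_form gexpz_x gexpz_y gexpz_z gexpz_t !hz_mulE; hz_ring.
Qed.

Lemma hz_hom_normal_form (G : groupType) (f : K -> G) g :
  {morph f : g h / g * h} -> f g = normal_form (f x) (f y) (f z) (f t) g.
Proof.
move=> fM; rewrite -{1}[g]hz_normal_form; case: g => [[[a b] c] m].
by rewrite /normal_form !fM !(gexpz_morph _ _ fM).
Qed.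

End Generators.

(** * The presented group in coordinates *)

Section Heisenberg.
Variables (n : nat).
Local Notation x := (heis_x n).
Local Notation y := (heis_y n).
Local Notation z := (heis_z n).

Lemma heis_zx : commute z x.
Proof. by apply/commgP; have [-> _ _] := heis_relP n. Qed.

Lemma heis_zy : commute z y.
Proof. by apply/commgP; have [_ -> _] := heis_relP n. Qed.

Lemma heis_yx : y * x = x * y * gexpz z n.
Proof. by have [_ _ yx] := heis_relP n; rewrite commgC yx. Qed.

Lemma ord3_inord (i : 'I_3) : [\/ i = inord 0, i = inord 1 | i = inord 2].
Proof.
case: i => -[|[|[|//]]] h; [apply: Or31|apply: Or32|apply: Or33];
  by apply: val_inj; rewrite /= inordK.
Qed.

(** Induction on a word for [g]: a new letter [y^s] in front crosses [x^a] at the cost of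
    [z^(n s a)]. *)
Lemma heis_normal_form (g : heis n) :
  exists a b c, g = gexpz x a * gexpz y b * gexpz z c.
Proof.
elim/pres_ind: g; elim=> [|[i e] w [a [b [c IH]]]].
  by exists 0%R, 0%R, 0%R; rewrite !mulg1.
rewrite -cat1s pres_classM IH.
have [s ->] : exists s, pres_class (heis_rels n) [:: (i, e)] =
    gexpz (pres_gen (heis_rels n) i) s.
  by case: e; [exists 1%R|exists (-1)%R; rewrite [RHS]/= -pres_classV].
have [] := ord3_inord i => ->.
- by exists (s + a)%R, b, c; rewrite gexpzD !mulgA.
- exists a, (s + b)%R, (n%:Z * s * a + c)%R; rewrite !mulgA.
  rewrite (gexpz_heis heis_zx heis_zy heis_yx) !gexpzD !mulgA.
  by rewrite -[_ * gexpz z _ * _]mulgA (gexpz_commute2 _ _ heis_zy) !mulgA.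
exists a, b, (s + c)%R; rewrite gexpzD !mulgA.
rewrite (gexpz_commute2 _ _ heis_zx) -(mulgA _ (gexpz z s) (gexpz y b)).
by rewrite (gexpz_commute2 _ _ heis_zy) !mulgA.
Qed.

(** Uniqueness of the normal form, in particular the infinite order of [z]: the presentation only
    bounds the group from above, and the map to the model shows that nothing collapses. *)
Lemma heis_coordinates (k l : int) : exists2 theta : heis n -> hz n k l,
  {morph theta : g h / g * h} &
  forall a b c, theta (gexpz x a * gexpz y b * gexpz z c) = (a, b, c, 0%R).
Proof.
pose f (i : 'I_3) : hz n k l :=
  nth 1 [:: gen_x n k l; gen_y n k l; gen_z n k l] i.
have f0 : f (inord 0) = gen_x n k l by rewrite /f inordK.
have f1 : f (inord 1) = gen_y n k l by rewrite /f inordK.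
have f2 : f (inord 2) = gen_z n k l by rewrite /f inordK.
have fnseq m : weval f (nseq m (inord 2, true)) = gen_z n k l ^+ m.
  elim: m => [|m IH]; first by rewrite /weval big_nil.
  by rewrite /weval big_cons expgS -IH /= f2.
have f_rels r : r \in heis_rels n -> weval f r.1 = weval f r.2.
  have fR (u v : 'I_3) : weval f (wcomm [:: (u, true)] [:: (v, true)]) =
      [~ f u, f v].
    by rewrite /weval !big_cons big_nil /= mulg1.
  rewrite !inE => /or3P[] /eqP -> /=; rewrite fR ?f0 ?f1 ?f2 ?fnseq.
  - by rewrite /weval big_nil; apply/eqP/commgP/gen_zx.
  - by rewrite /weval big_nil; apply/eqP/commgP/gen_zy.
  by apply: (@mulgI _ (gen_x n k l * gen_y n k l)); rewrite -commgC gen_yx.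
have pM : {morph pres_lift (rels := heis_rels n) f : g h / g * h}.
  exact: pres_liftM.
exists (pres_lift (rels := heis_rels n) f) => // a b c.
rewrite !pM !(gexpz_morph _ _ pM) !pres_lift_gen // f0 f1 f2.
by rewrite -[RHS]hz_normal_form /normal_form mulg1.
Qed.

(** The image of [z] is central, and for [n > 0] commuting with [x] and [y] makes it a power [z^c].
    Inverting both [x] and [y] modulo [z] preserves their commutator [z^n], so [n c = n]. *)
Lemma heis_aut_z (k l : int) (psi : aut (heis n)) : (0 < n)%N ->
  psi x = x^-1 * gexpz z k -> psi y = y^-1 * gexpz z l -> psi z = z.
Proof.
move=> n_gt0 psix psiy.
have [theta thetaM thetaE] := heis_coordinates k l.
have psiM : {morph psi : g h / g * h} by move=> g h; rewrite gmulfM.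
have psiz_comm g : commute z g -> commute (psi z) (psi g).
  by move=> zg; rewrite /commute -!gmulfM zg.
have psi_comm g : commute (psi z) g.
  rewrite -(aut_invK psi g); apply: psiz_comm.
  have [a [b [c ->]]] := heis_normal_form (aut_inv psi g).
  have zc u i : commute z u -> commute z (gexpz u i) by apply: gexpz_commute.
  by do 2?apply: commuteM; apply: zc; [exact: heis_zx | exact: heis_zy |].
have thx : theta x = (1, 0, 0, 0)%R by rewrite -thetaE !mulg1.
have thy : theta y = (0, 1, 0, 0)%R by rewrite -thetaE mulg1 mul1g.
have thpx : theta (psi x) = (-1, 0, k, 0)%R by rewrite -thetaE psix mulg1.
have thpy : theta (psi y) = (0, -1, l, 0)%R by rewrite -thetaE psiy mul1g.
have [a [b [c psiz]]] := heis_normal_form (psi z).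
have thpz : theta (psi z) = (a, b, c, 0)%R by rewrite psiz thetaE.
have b0 : b = 0%R.
  have := congr1 theta (psi_comm x).
  rewrite !thetaM thpz thx !hz_mulE => /(congr1 (fun g => g.1.2)).
  rewrite /psign /parity /=; nia.
have a0 : a = 0%R.
  have := congr1 theta (psi_comm y).
  rewrite !thetaM thpz thy !hz_mulE => /(congr1 (fun g => g.1.2)).
  rewrite /psign /parity /=; nia.
have c1 : c = 1%R.
  have := congr1 psi heis_yx; rewrite !psiM (gexpz_morph _ _ psiM).
  move=> /(congr1 theta); rewrite !thetaM.
  rewrite (gexpz_morph _ _ thetaM) thpz a0 b0 -gexpz_z -gexpzM gexpz_z.
  rewrite thpx thpy.
  rewrite !hz_mulE => /(congr1 (fun g => g.1.2)).
  rewrite /psign /parity /=; nia.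
by rewrite psiz a0 b0 c1 !mul1g.
Qed.

Lemma sdprodZ_heis_iso (k l : int) (psi : aut (heis n)) : (0 < n)%N ->
  psi x = x^-1 * gexpz z k -> psi y = y^-1 * gexpz z l ->
  exists2 rho : hz n k l -> sdprodZ psi,
    {morph rho : g h / g * h} & bijective rho.
Proof.
move=> n_gt0 psix psiy; have psiz := heis_aut_z n_gt0 psix psiy.
pose inj : heis n -> sdprodZ psi := fun g => (g, 0%R).
have injM : {morph inj : g h / g * h} by [].
pose t : sdprodZ psi := (1, 1%R).
have tE m : gexpz t m = (1, m).
  apply: (gexpz_unique (f := fun m => (1, m) : sdprodZ psi)) => // i.
  by rewrite -[RHS]/((1 * aut_pow psi i 1, _)) aut_pow1 mulg1.
have tM g : t * inj g = (psi g, 1%R).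
  by rewrite -[LHS]/((1 * psi g, _)) mul1g.
have Mt g m : inj g * (1, m) = (g, m) :> sdprodZ psi.
  by rewrite -[LHS]/((g * 1, (0 + m)%R)) mulg1 GRing.add0r.
pose rho := @normal_form n k l (sdprodZ psi) (inj x) (inj y) (inj z) t.
have rhoE a b c m :
    rho (a, b, c, m) = (gexpz x a * gexpz y b * gexpz z c, m).
  by rewrite /rho /normal_form -!(gexpz_morph _ _ injM) -!injM tE Mt.
exists rho.
  have injV g : (inj g)^-1 = inj g^-1.
    by apply: (@mulgI _ (inj g)); rewrite mulgV.
  apply: normal_formM.
  - by rewrite /commute -!injM heis_zx.
  - by rewrite /commute -!injM heis_zy.
  - by rewrite -(gexpz_morph _ _ injM) -!injM heis_yx.
  - by rewrite /commute tM psiz Mt.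
  - by rewrite tM psix injV -(gexpz_morph _ _ injM) -injM Mt.
  by rewrite tM psiy injV -(gexpz_morph _ _ injM) -injM Mt.
have [theta _ thetaE] := heis_coordinates k l.
pose rhoV (u : sdprodZ psi) : hz n k l :=
  let: (a, b, c, _) := theta u.1 in (a, b, c, u.2).
exists rhoV => [[[[a b] c] m]|[g m]].
  by rewrite rhoE /rhoV thetaE.
have [a [b [c ->]]] := heis_normal_form g.
by rewrite /rhoV thetaE rhoE.
Qed.

End Heisenberg.

(** * Counting twisted conjugacy classes *)

Section ReidemeisterNumbers.
Local Open Scope classical_set_scope.
Implicit Types G K : groupType.

Lemma rconjE G (phi : G -> G) g h :
  rconj phi g h <-> exists w, g * phi w = w * h.
Proof.
split=> [[w ->]|[w gw]]; first by exists w; rewrite mulgVK.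
by exists w; rewrite -gw mulgK.
Qed.

Lemma rconj_refl G (phi : aut G) g : rconj phi g g.
Proof. by exists 1; rewrite (morph1 (@autM _ phi)) invg1 mulg1 mul1g. Qed.

Lemma rconj_trans G (phi : aut G) g h u :
  rconj phi g h -> rconj phi h u -> rconj phi g u.
Proof.
by move=> [v ->] [w ->]; exists (v * w); rewrite autM invgM !mulgA.
Qed.

Lemma rconj_sym G (phi : aut G) g h : rconj phi g h -> rconj phi h g.
Proof.
move=> [w ->]; exists w^-1.
by rewrite (morphV _ (@autM _ phi)) invgK -!mulgA mulVg mulg1 mulKg.
Qed.

Lemma eq_rconj_class G (phi : aut G) g h :
  ([set u | rconj phi g u] = [set u | rconj phi h u]) <-> rconj phi g h.
Proof.
split=> [gh|gh].
  have : [set u | rconj phi h u] h by exact: rconj_refl.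
  by rewrite -gh.
apply/seteqP; split=> u /=; apply: rconj_trans => //; exact: rconj_sym.
Qed.

Lemma reidemeister_Some G (phi : aut G) (T : finType) (f : G -> T) :
  (forall t, exists g, f g = t) ->
  (forall g h, rconj phi g h <-> f g = f h) -> reidemeister phi = Some #|T|.
Proof.
move=> f_surj f_rconj; pose C g := [set u | rconj phi g u].
have [s sK] := choice f_surj.
have CsI : injective (C \o s).
  by move=> t t' /= /eq_rconj_class/f_rconj; rewrite !sK.
have RE : reidemeister_classes phi = [set` [fset (C \o s) t | t in T]%fset].
  apply/seteqP; split=> [_ [g _ <-]|_ /imfsetP[t _ ->]] /=; last first.
    by exists (s t).
  apply/imfsetP; exists (f g) => //=.
  by apply/eq_rconj_class/f_rconj; rewrite sK.
rewrite /reidemeister asboolT.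
  by rewrite RE set_fsetK card_imfset //= cardE.
by rewrite RE; apply: finite_fset.
Qed.

Lemma reidemeister_None G (phi : aut G) (u : nat -> G) :
  (forall i j, rconj phi (u i) (u j) -> i = j) -> reidemeister phi = None.
Proof.
move=> u_inj; rewrite /reidemeister asboolF // => fin.
pose C i := [set v | rconj phi (u i) v].
have CI : {in [set: nat] &, injective C}.
  by move=> i j _ _ /eq_rconj_class/u_inj.
apply: infinite_nat; rewrite -(eq_finite_set (inj_card_eq CI)).
by apply: sub_finite_set fin => _ [i _ <-]; exists (u i).
Qed.

Lemma reidemeister_conj G K (rho : K -> G) (phi : aut G) (phi' : aut K) :
  {morph rho : g h / g * h} -> bijective rho ->
  (forall g, phi (rho g) = rho (phi' g)) ->
  reidemeister phi = reidemeister phi'.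
Proof.
move=> rhoM [rhoV rhoK rhoVK] phi_rho.
have rhoI := can_inj rhoK.
have rho_rconj g h : rconj phi (rho g) (rho h) <-> rconj phi' g h.
  split=> [[w gh]|[w ->]]; last first.
    by exists (rho w); rewrite phi_rho !rhoM morphV.
  exists (rhoV w); apply: rhoI; rewrite !rhoM morphV // -phi_rho.
  by rewrite rhoVK.
have RE : reidemeister_classes phi =
    [set rho @` A | A in reidemeister_classes phi'].
  have cE g : [set h | rconj phi (rho g) h] = rho @` [set h | rconj phi' g h].
    apply/seteqP; split=> [h gh|_ [h gh <-]]; last exact/rho_rconj.
    by exists (rhoV h) => //=; apply/rho_rconj; rewrite rhoVK.
  apply/seteqP; split=> [_ [g _ <-]|_ [_ [g _ <-] <-]].
    exists [set h | rconj phi' (rhoV g) h]; first by exists (rhoV g).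
    by rewrite -cE rhoVK.
  by exists (rho g).
have RI : {in reidemeister_classes phi' &, injective (fun A => rho @` A)}.
  move=> A B _ _ AB; apply/seteqP; split=> g.
    by rewrite -(image_inj rhoI) AB (image_inj rhoI).
  by rewrite -(image_inj rhoI) -AB (image_inj rhoI).
have RC := inj_card_eq RI; rewrite -RE in RC.
rewrite /reidemeister (eq_finite_set RC).
case: asboolP => // /finite_setP[m Rm].
by rewrite (card_fset_set Rm) (card_fset_set (card_eq_trans RC Rm)).
Qed.

Lemma aut_of G (f : G -> G) (fM : {morph f : g h / g * h})
    (f_inj : injective f) (f_surj : forall h, exists g, f g = h) :
  {phi : aut G | phi =1 f}.
Proof.
have [g gK] := choice f_surj.
have fK : cancel f g by move=> u; apply: f_inj; rewrite gK.
pose f' := HB.pack_for {multiplicative G -> G} f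
  (isMultiplicative.Build _ _ f fM).
by exists (@Aut _ f' g fK gK).
Qed.

Lemma reidemeister_spectrum_iso G K (rho : K -> G) :
  {morph rho : g h / g * h} -> bijective rho ->
  reidemeister_spectrum G = reidemeister_spectrum K.
Proof.
move=> rhoM rho_bij; have [rhoV rhoK rhoVK] := rho_bij.
have rhoVM : {morph rhoV : g h / g * h}.
  by move=> g h; apply: (can_inj rhoK); rewrite rhoM !rhoVK.
have autI H (psi : aut H) : injective psi by apply: can_inj; apply: aut_funK.
apply/seteqP; split=> _ [phi _ <-].
  have [||h|phi' phi'E] := @aut_of K (rhoV \o phi \o rho).
  - by move=> g h /=; rewrite rhoM autM rhoVM.
  - by move=> g h /= /(can_inj rhoVK)/autI/(can_inj rhoK).
  - by exists (rhoV (aut_inv phi (rho h))); rewrite /= rhoVK aut_invK rhoK.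
  exists phi' => //; apply/esym/(reidemeister_conj rhoM) => // g.
  by rewrite phi'E /= rhoVK.
have [||h|phi' phi'E] := @aut_of G (rho \o phi \o rhoV).
- by move=> g h /=; rewrite rhoVM autM rhoM.
- by move=> g h /= /(can_inj rhoK)/autI/(can_inj rhoVK).
- by exists (rho (aut_inv phi (rhoV h))); rewrite /= rhoK aut_invK rhoVK.
exists phi' => //; apply/(reidemeister_conj rhoM) => // g.
by rewrite phi'E /= rhoK.
Qed.

End ReidemeisterNumbers.

(** * Residues and the index of a lattice in [Z^2] *)

Lemma residue_class (h : nat) : (0 < h)%N ->
  exists f : int -> 'I_h, (forall t : 'I_h, f (Posz t) = t) /\
    (forall x y, f x = f y <-> exists q : int, x = (y + q * h%:Z)%R).
Proof.
move=> h_gt0; have h0 : (h%:Z != 0)%R by lia.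
have lt_h x : (`|(x %% h)%Z|%N < h)%N by have := ltz_pmod x (d := h); lia.
exists (fun x => Ordinal (lt_h x)); split=> [t|x y].
  by apply: val_inj; rewrite /= modz_nat absz_nat modn_small.
split=> [/(congr1 val) /= xy|[q ->]]; last first.
  by apply: val_inj; rewrite /= GRing.addrC modzMDl.
have {}xy : (x %% h)%Z = (y %% h)%Z.
  by rewrite -[LHS]gez0_abs ?modz_ge0 // xy gez0_abs ?modz_ge0.
exists ((x %/ h)%Z - (y %/ h)%Z)%R.
by rewrite {1}(divz_eq x h) xy {2}(divz_eq y h); ring.
Qed.

(* Column reduction: with [g = gcd(c, d)] the lattice spanned by the columns is
   that of a triangular matrix with diagonal entries [(a d - b c) / g] and [g]. *)
Lemma lattice_index (a b c d : int) : (a * d - b * c != 0)%R ->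
  exists (T : finType) (f : int * int -> T),
  [/\ #|T| = `|(a * d - b * c)%R|%N, forall t, exists v, f v = t &
   forall v w, f v = f w <-> exists u1 u2 : int,
     v = (w.1 + (a * u1 + b * u2), w.2 + (c * u1 + d * u2))%R].
Proof.
move=> D0; set g := gcdz c d.
have [s [r bez]] := Bezoutz c d; rewrite -/g in bez.
have g_ge0 : (0 <= g :> int)%R by [].
have g0 : g != 0%R.
  apply: contraNneq D0 => /eqP; rewrite gcdz_eq0 => /andP[/eqP -> /eqP ->].
  lia.
have [c' cE] : exists c' : int, c = (c' * g)%R by apply/dvdzP/dvdz_gcdl.
have [d' dE] : exists d' : int, d = (d' * g)%R by apply/dvdzP/dvdz_gcdr.
have bez' : (s * c' + r * d' = 1)%R.
  apply: (GRing.mulIf g0); rewrite GRing.mul1r -[RHS]bez cE dE; ring.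
pose D' : int := (a * d' - b * c')%R.
have DE : (a * d - b * c = D' * g)%R by rewrite cE dE /D'; ring.
have D'0 : D' != 0%R by apply: contraNneq D0 => D'0; rewrite DE D'0 GRing.mul0r.
have [|p [pK pP]] := @residue_class `|g|%N; first lia.
have [|q [qK qP]] := @residue_class `|D'|%N; first lia.
(* The Bezout combination of the columns is [(a s + b r, g)]; subtracting a multiple of it brings
   the second coordinate into [[0, g)]. Lattice vectors with second coordinate 0 are the multiples
   of [(D', 0)]. *)
pose sh (v : int * int) := (v.1 - (v.2 %/ g)%Z * (a * s + b * r))%R.
exists ('I_`|g| * 'I_`|D'|)%type, (fun v => (p v.2, q (sh v))); split.
- by rewrite card_prod !card_ord DE abszM mulnC.
- move=> [i j]; exists (Posz j, Posz i); rewrite /sh /= divz_small.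
    by rewrite GRing.mul0r GRing.subr0 pK qK.
  by rewrite lez_nat ltz_nat ltn_ord.
have gE : Posz `|g|%N = g by lia.
have divM m e : ((m + e * g) %/ g)%Z = ((m %/ g)%Z + e)%R.
  by rewrite GRing.addrC divzMDl // GRing.addrC.
have [sg [sgE sgE']] : exists sg : int,
    (Posz `|D'|%N = sg * D' /\ D' = sg * Posz `|D'|%N)%R.
  have [D'_ge0|D'_lt0] : (0 <= D' \/ D' < 0)%R by lia.
    by exists 1%R; lia.
  by exists (-1)%R; lia.
move=> [x y] [x' y']; rewrite /sh /=; split.
  move=> [/pP[e ->]]; rewrite gE divM => /qP[e' xE].
  rewrite sgE in xE.
  (* This is [e] times the Bezout combination [(s, r)] plus [e' sg] times [(d', - c')], the
     combination that yields [(D', 0)]. *)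
  exists (e * s + e' * sg * d')%R, (e * r - e' * sg * c')%R; congr (_, _)%R.
    have -> : x = (x' - (y' %/ g)%Z * (a * s + b * r) + e' * (sg * D') +
        ((y' %/ g)%Z + e) * (a * s + b * r))%R by rewrite -xE; ring.
    by rewrite /D'; ring.
  have cd : (c * d' = d * c')%R by rewrite cE dE; ring.
  transitivity (y' + e * (s * c + r * d) + e' * sg * (c * d' - d * c'))%R.
    by rewrite bez cd; ring.
  ring.
move=> [u1 [u2 [-> ->]]].
have yE : (y' + (c * u1 + d * u2) = y' + (c' * u1 + d' * u2) * g)%R.
  by rewrite {1}cE {1}dE; ring.
congr (_, _); first by apply/pP; exists (c' * u1 + d' * u2)%R; rewrite gE.
(* By [bez'], the pairs [(s, r)] and [(d', - c')] form a basis of [Z^2]; the coordinates of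
   [(u1, u2)] in it are [c' u1 + d' u2] and [r u1 - s u2]. *)
apply/qP; exists ((r * u1 - s * u2) * sg)%R.
rewrite yE divM -GRing.mulrA -sgE' /D'.
have -> : (a * u1 + b * u2 = (s * c' + r * d') * (a * u1 + b * u2))%R.
  by rewrite bez' GRing.mul1r.
ring.
Qed.

(* A central infinite cyclic subgroup inverted by [phi] doubles the Reidemeister
   number of the quotient when twisted stabilizers in the quotient are trivial. *)
Lemma reidemeister_central_ext (G : groupType) (phi : aut G) (zeta : int -> G)
    (T : finType) (f : G -> T) :
  (forall c d, zeta (c + d)%R = zeta c * zeta d) ->
  (forall c g, commute (zeta c) g) -> (forall c, phi (zeta c) = zeta (- c)%R) ->
  injective zeta -> (forall t, exists g, f g = t) ->
  (forall g h, f g = f h <-> exists c, rconj phi g (zeta c * h)) ->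
  (forall w g c, g * phi w = w * (zeta c * g) -> exists d, w = zeta d) ->
  reidemeister phi = Some (#|T| * 2)%N.
Proof.
move=> zD zC phiz zI f_surj fP stab.
have z0 : zeta 0%R = 1 by apply: (@mulgI _ (zeta 0%R)); rewrite -zD mulg1.
(* Conjugating by [zeta d] shifts the exponent by [2 d], and [stab] excludes every other
   conjugator. *)
have z_rconj r i j :
    rconj phi (zeta i * r) (zeta j * r) <-> oddz i = oddz j.
  split=> [/rconjE[w E]|ij].
    have Ew : r * phi w = w * (zeta (j - i)%R * r).
      apply: (@mulgI _ (zeta i)); rewrite mulgA E.
      rewrite [RHS]mulgA (zC i w) -[RHS]mulgA.
      by congr (w * _); rewrite [RHS]mulgA -zD GRing.addrC GRing.subrK.
    have [d wE] := stab _ _ _ Ew; move: E; rewrite wE phiz -mulgA -zC !mulgA.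
    rewrite -!zD => /mulIg/zI E.
    by rewrite (_ : i = j + (d + d))%R ?oddzD ?addbb ?addbF //; lia.
  have [d dE] : exists d : int, (i = d + j + d)%R.
    exists ((i - j) %/ 2)%Z.
    by move: ij; rewrite /oddz; lia.
  apply/rconjE; exists (zeta d); rewrite phiz dE.
  by rewrite -mulgA -zC !mulgA -!zD; congr (zeta _ * _); ring.
have [r rK] := choice f_surj.
(* The exponent relative to the representative of the fibre is a choice, but its parity is an
   invariant. *)
have [c cE] : {c : G -> int | forall g, rconj phi g (zeta (c g) * r (f g))}.
  have /choice[c cE] g : exists i, rconj phi g (zeta i * r (f g)).
    by apply/fP; rewrite rK.
  by exists c.
have fz i g : f (zeta i * g) = f g.
  by apply/fP; exists i; apply: rconj_refl.
have -> : (#|T| * 2)%N = #|{: T * bool}| by rewrite card_prod card_bool.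
apply: (reidemeister_Some (f := fun g => (f g, oddz (c g)))) => [[t b]|g h].
  exists (zeta (b : nat)%:Z%R * r t); rewrite fz rK; congr (_, _).
  have := cE (zeta (b : nat)%:Z%R * r t); rewrite fz rK => /z_rconj <-.
  by case: b.
split=> [gh|[fgh cgh]].
  have fgh : f g = f h by apply/fP; exists 0%R; rewrite z0 mul1g.
  congr (_, _) => //; apply/(z_rconj (r (f g))).
  apply: rconj_trans (rconj_trans (rconj_sym (cE g)) gh) _.
  by rewrite fgh.
apply: rconj_trans (cE g) (rconj_trans _ (rconj_sym (cE h))).
by rewrite fgh; apply/z_rconj.
Qed.

Lemma half_parity m : m = (2 * (m %/ 2)%Z + parity m)%R.
Proof. by rewrite /parity /oddz; lia. Qed.

(** * Automorphisms of the model and their Reidemeister numbers *)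

Lemma det_neq0_kernel (a' b' c' d' u v : int) : (a' * d' - b' * c' != 0)%R ->
  (a' * u + b' * v = 0)%R -> (c' * u + d' * v = 0)%R -> u = 0%R /\ v = 0%R.
Proof.
move=> D0 E1 E2; split; apply/(GRing.mulfI D0); rewrite GRing.mulr0.
  transitivity (d' * (a' * u + b' * v) - b' * (c' * u + d' * v))%R.
    by ring.
  by rewrite E1 E2; ring.
transitivity (a' * (c' * u + d' * v) - c' * (a' * u + b' * v))%R; first by ring.
by rewrite E1 E2; ring.
Qed.

Section AutReidemeister.
Variables (n : nat) (k l : int).
Local Notation K := (hz n k l).

Definition vec (g : K) : int * int * int := let: (u, v, _, m) := g in (u, v, m).
Definition center (i : int) : K := (0, 0, i, 0)%R.

Lemma vec_inj (u v m u' v' m' : int) :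
  (u, v, m) = (u', v', m') -> [/\ u = u', v = v' & m = m'].
Proof. by case. Qed.

Lemma vecP g h : vec g = vec h -> exists i, g = center i * h.
Proof.
move: g h => [[[u v] w] m] [[[u' v'] w'] m'] [-> -> ->]; exists (w - w')%R.
by rewrite hz_mulE; hz_ring.
Qed.

Lemma vec_center g i : vec (center i * g) = vec g.
Proof.
move: g => [[[u v] w] m]; rewrite hz_mulE /vec /=.
by congr (_, _, _)%R; rewrite /psign /parity /=; ring.
Qed.

Lemma centerC i g : commute (center i) g.
Proof.
move: g => [[[u v] w] m]; rewrite /commute !hz_mulE.
by hz_ring.
Qed.

Lemma vec_center_mid g i h : vec (g * (center i * h)) = vec (g * h).
Proof. by rewrite mulgA -centerC -mulgA vec_center. Qed.

Lemma vecM u v w m u' v' w' m' :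
  vec (((u, v, w, m) : K) * ((u', v', w', m') : K)) =
  (u + psign m * u', v + psign m * v', m + m')%R.
Proof. by []. Qed.

(** The [z]-coordinate is left existential, here and below: the arguments work modulo [<z>] or
    correct it afterwards by a central factor. *)
Lemma vec_gexpz a c p i :
  exists p', gexpz ((a, c, p, 0)%R : K) i = (a * i, c * i, p', 0)%R.
Proof.
move: i; apply: int_step_ind => [|i]; first by exists 0%R; rewrite !GRing.mulr0.
rewrite gexpzS; split=> [[p' ->]|[p' E]].
  by eexists; rewrite hz_mulE; hz_ring.
rewrite -[gexpz _ i](mulgK ((a, c, p, 0)%R : K)) E.
have -> : ((a, c, p, 0)%R : K)^-1 = (- a, - c, n%:Z * a * c - p, 0)%R.
  by hz_ring.
by eexists; rewrite hz_mulE; hz_ring.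
Qed.

(** An element of odd degree acts on [Z^2] as [-1], so the first two coordinates of its square
    vanish. *)
Lemma vec_gexpz_odd e f r s m : oddz s -> 
  exists r', gexpz ((e, f, r, s) : K) m =
    (parity m * e, parity m * f, r', s * m)%R.
Proof.
move=> s_odd.
have sg : psign s = (-1)%R by rewrite /psign /parity s_odd.
have pm i : parity (s * i) = parity i by rewrite /parity oddzM s_odd.
move: m; apply: int_step_ind => [|i].
  by exists 0%R; rewrite !GRing.mulr0 !GRing.mul0r.
rewrite gexpzS; split=> [[p' ->]|[p' E]].
  eexists; rewrite hz_mulE {1 2}/psign pm parityD.
  by congr (_, _, _, _)%R; rewrite /parity /=; ring.
rewrite -[gexpz _ i](mulgK ((e, f, r, s)%R : K)) E.
have -> : ((e, f, r, s)%R : K)^-1 = hz_inv ((e, f, r, s) : K) by [].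
rewrite /hz_inv sg.
eexists; rewrite hz_mulE {1 2}/psign pm parityD.
by congr (_, _, _, _)%R; rewrite /parity /=; ring.
Qed.

Lemma vec_normal_form (a b c d p q e f r s delta u v w m : int) : oddz s ->
  exists w', normal_form ((a, c, p, 0) : K)%R ((b, d, q, 0) : K)%R
    (center delta) ((e, f, r, s) : K) ((u, v, w, m) : K) =
  (a * u + b * v + parity m * e, c * u + d * v + parity m * f, w', s * m)%R.
Proof.
move=> s_odd; rewrite /normal_form.
have [p' ->] := vec_gexpz a c p u; have [q' ->] := vec_gexpz b d q v.
rewrite /center -[(_, _, delta, _)]gexpz_z -gexpzM gexpz_z.
have [r' ->] := vec_gexpz_odd e f r m s_odd.
by eexists; rewrite !hz_mulE; hz_ring.
Qed.

Variables (phi : aut K) (a b c d p q e f r s delta : int).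
Hypothesis phix : phi (gen_x n k l) = (a, c, p, 0)%R.
Hypothesis phiy : phi (gen_y n k l) = (b, d, q, 0)%R.
Hypothesis phiz : phi (gen_z n k l) = (0, 0, delta, 0)%R.
Hypothesis phit : phi (gen_t n k l) = (e, f, r, s).
Hypothesis s_odd : oddz s.

Lemma phi_center i : phi (center i) = center (delta * i).
Proof.
rewrite /center -gexpz_z (gexpz_morph _ _ (@autM _ phi)) phiz.
by rewrite -[(_, _, delta, _)]gexpz_z -gexpzM gexpz_z.
Qed.

Lemma phi_vec u v w m : exists w', phi (u, v, w, m) =
  (a * u + b * v + parity m * e, c * u + d * v + parity m * f, w', s * m)%R.
Proof.
rewrite (hz_hom_normal_form _ (@autM _ phi)) phix phiy phiz phit.
exact: vec_normal_form.
Qed.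

(** The degree is then constant on twisted conjugacy classes and separates the powers of [t]. *)
Lemma reidemeister_pos : s = 1%R -> reidemeister phi = None.
Proof.
move=> s1.
apply: (reidemeister_None (u := fun i => (0, 0, 0, i%:Z)%R : K)) => i j.
move=> /rconjE[[[[u v] w] m]]; have [w' ->] := phi_vec u v w m.
by rewrite s1 => /(congr1 vec); rewrite !vecM => /vec_inj[_ _]; lia.
Qed.

Hypothesis sN1 : s = (-1)%R.

(** A nonzero row vector [(x, y)] fixed by the matrix gives a functional [x u + y v] that is
    invariant under conjugators of degree 0, the only ones between elements of degree 0. It
    separates the multiples of [(x, y)]. *)
Lemma reidemeister_singular : ((1 - a) * (1 - d) - b * c = 0)%R ->
  reidemeister phi = None.
Proof.
move=> D0.
(* The candidates are the cofactor vectors [(c, 1 - a)] and [(1 - d, b)]; if both vanish, the matrix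
   is the identity. *)
have [x [y [xy0 x_eq y_eq]]] : exists x y : int, [/\ (x * x + y * y != 0)%R,
    (x * a + y * c = x)%R & (x * b + y * d = y)%R].
  have [ca0|ca0] := boolP ((c == 0)%R && (a == 1)%R).
    have [bd0|bd0] := boolP ((b == 0)%R && (d == 1)%R).
      by exists 1%R, 0%R; split; lia.
    by exists (1 - d)%R, b; split; nia.
  by exists c, (1 - a)%R; split; nia.
pose g (i : nat) : K := (i%:Z * x, i%:Z * y, 0, 0)%R.
apply: (reidemeister_None (u := g)) => i j.
move=> /rconjE[[[[u v] w] m]]; have [w' ->] := phi_vec u v w m.
move=> /(congr1 vec); rewrite !vecM sN1 => /vec_inj[E1 E2 E3].
have m0 : m = 0%R by lia.
move: E1 E2; rewrite m0 /psign /parity /= => E1 E2.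
have E : ((i%:Z - j%:Z) * (x * x + y * y) = 0)%R.
  transitivity (x * (i%:Z * x + (1 - 2 * 0) * (a * u + b * v + 0 * e))
    + y * (i%:Z * y + (1 - 2 * 0) * (c * u + d * v + 0 * f))
    - (x * a + y * c) * u - (x * b + y * d) * v
    - j%:Z * (x * x + y * y))%R; first by ring.
  by rewrite E1 E2 x_eq y_eq; ring.
by move/eqP: E; rewrite GRing.mulf_eq0 (negbTE xy0) orbF; lia.
Qed.

(** A conjugator between powers of [z] has degree 0 and a vector fixed by the matrix, hence zero. It
    is a power of [z], which [phi] fixes, so it moves nothing. *)
Lemma reidemeister_central : ((1 - a) * (1 - d) - b * c != 0)%R ->
  delta = 1%R -> reidemeister phi = None.
Proof.
move=> D0 delta1; apply: (reidemeister_None (u := fun i => center i)) => i j.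
move=> /rconjE[[[[u v] w] m] E].
have m0 : m = 0%R.
  have [w' phiE] := phi_vec u v w m; move: E; rewrite phiE sN1.
  by move=> /(congr1 vec); rewrite !vecM => /vec_inj[_ _]; lia.
have [u0 v0] : u = 0%R /\ v = 0%R.
  have [w' phiE] := phi_vec u v w m; move: E; rewrite phiE sN1 m0.
  move=> /(congr1 vec); rewrite !vecM /psign /parity /= => /vec_inj[E1 E2 _].
  by apply: (@det_neq0_kernel (1 - a)%R (- b)%R (- c)%R (1 - d)%R); lia.
move: E; rewrite m0 u0 v0 -/(center w) phi_center delta1 !hz_mulE.
by move=> /(congr1 (fun g => g.1.2)); rewrite /psign /parity /=; lia.
Qed.

(** For [g] of degree [m], conjugating by an element of [H_n] with vector [v] adds [v - psign m M v]
    to the vector of [g]. Modulo [<z>] this leaves [|tr M|] classes in each of the degrees 0 and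
    1. *)
Lemma reidemeister_finite : delta = (-1)%R -> (a * d - b * c = -1)%R ->
  (a + d != 0)%R -> reidemeister phi = Some (4 * `|(a + d)%R|)%N.
Proof.
move=> deltaN1 detN1 tr0.
have [|T0 [f0 [T0c f0_surj f0P]]] :=
  @lattice_index (1 - a)%R (- b)%R (- c)%R (1 - d)%R; first lia.
have [|T1 [f1 [T1c f1_surj f1P]]] :=
  @lattice_index (1 + a)%R b c (1 + d)%R; first lia.
(* Twisted conjugation by a power of [t] moves [g] to degree [parity m]; its first
   two coordinates, modulo the image of [1 - M] (degree 0) or [1 + M] (degree 1),
   then determine the class modulo the centre. *)
pose v0 (g : K) : int * int := let: (u, v, _, m) := g in let i := (m %/ 2)%Z in
  (psign i * u - psign m * parity i * e,
   psign i * v - psign m * parity i * f)%R.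
pose F (g : K) : T0 + T1 :=
  if oddz g.2 then inr (f1 (v0 g)) else inl (f0 (v0 g)).
rewrite (_ : 4 * _ = #|{: T0 + T1}| * 2)%N; last first.
  by rewrite card_sum T0c T1c; lia.
apply: (reidemeister_central_ext (zeta := center) (f := F)).
- by move=> i j; rewrite /center -!gexpz_z gexpzD.
- exact: centerC.
- by move=> i; rewrite phi_center deltaN1 GRing.mulN1r.
- by move=> i j [].
- move=> [t|t].
    have [[u v] <-] := f0_surj t; exists (u, v, 0, 0)%R; rewrite /F /v0 /=.
    by congr (inl (f0 (_, _))); rewrite /psign /parity /=; ring.
  have [[u v] <-] := f1_surj t; exists (u, v, 0, 1)%R; rewrite /F /v0 /=.
  by congr (inr (f1 (_, _))); rewrite /psign /parity /=; ring.
- move=> [[[u v] w] m] [[[u' v'] w'] m'].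
  set i := (m %/ 2)%Z; set i' := (m' %/ 2)%Z.
  have mE : m = (2 * i + parity m)%R := half_parity m.
  have mE' : m' = (2 * i' + parity m')%R := half_parity m'.
  (* Both lattice conditions in one formula: [psign m] selects [1 - M] or [1 + M]. *)
  have FP : F (u, v, w, m) = F (u', v', w', m') <->
      parity m = parity m' /\ exists u1 u2 : int,
      (psign i * u - psign m * parity i * e = psign i' * u'
        - psign m * parity i' * e
        + ((1 - psign m * a) * u1 - psign m * b * u2))%R /\
      (psign i * v - psign m * parity i * f = psign i' * v'
        - psign m * parity i' * f
        + (- psign m * c * u1 + (1 - psign m * d) * u2))%R.
    rewrite /F /v0 /= -/i -/i' /psign [parity m]/parity [parity m']/parity.
    case: (oddz m); case: (oddz m'); last first.
    - split=> [[/f0P[u1 [u2 E]]]|[_ [u1 [u2 [E1 E2]]]]].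
        split=> //; exists u1, u2.
        by move: (congr1 fst E) (congr1 snd E) => /=; lia.
      by congr inl; apply/f0P; exists u1, u2; congr (_, _) => /=; lia.
    - by split=> [|[]].
    - by split=> [|[]].
    split=> [[/f1P[u1 [u2 E]]]|[_ [u1 [u2 [E1 E2]]]]].
      split=> //; exists u1, u2.
      by move: (congr1 fst E) (congr1 snd E) => /=; lia.
    by congr inr; apply/f1P; exists u1, u2; congr (_, _) => /=; lia.
  rewrite {}FP; split=> [[pm [x [y [Ex Ey]]]]|[j /rconjE[[[[x y] w''] h] E]]].
    (* A conjugator of degree [h] shifts the degree by [2 h], hence [i - i']. The sign [psign i]
       undoes the one that [v0] introduces when normalizing the degree. *)
    pose W : K := (psign i * x, psign i * y, 0, i - i')%R.
    have [|j jE] := @vecP (((u, v, w, m) : K) * phi W)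
        (W * ((u', v', w', m') : K)).
      have [w1 ->] := phi_vec (psign i * x)%R (psign i * y)%R 0%R (i - i')%R.
      rewrite /W !vecM sN1 psignD psignN parityD parityN.
      move: Ex Ey; rewrite /psign /parity.
      by case: (oddz i); case: (oddz i') => /= Ex Ey; congr (_, _, _)%R; lia.
    by exists j; apply/rconjE; exists W; rewrite jE mulgA centerC mulgA.
  have [w1 phiE] := phi_vec x y w'' h; move: E; rewrite phiE sN1.
  move=> /(congr1 vec); rewrite vec_center_mid !vecM => /vec_inj[E1 E2 E3].
  have mm' : m = (m' + 2 * h)%R by lia.
  have pm : parity m = parity m'.
    by rewrite mm' parityD /parity oddzM /=; lia.
  have ii' : i = (i' + h)%R by lia.
  split=> //; exists (psign i * x)%R, (psign i * y)%R.
  move: E1 E2; rewrite ii' psignD parityD /psign /parity.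
  by case: (oddz i'); case: (oddz h) => /= E1 E2; split; lia.
move=> [[[x y] w] j] [[[u v] w'] m] i.
have [w'' ->] := phi_vec x y w j; move=> /(congr1 vec).
rewrite vec_center_mid !vecM sN1 => /vec_inj[E1 E2 E3].
have j0 : j = 0%R by lia.
exists w; rewrite j0; suff [-> ->] : x = 0%R /\ y = 0%R by [].
move: E1 E2; rewrite j0 /psign /parity /=; case: (oddz m) => /= E1 E2.
  by apply: (@det_neq0_kernel (1 + a)%R b c (1 + d)%R); lia.
by apply: (@det_neq0_kernel (1 - a)%R (- b)%R (- c)%R (1 - d)%R); lia.
Qed.

End AutReidemeister.

(** * Automorphisms of the model as solutions of integer equations *)

Lemma int_mul_eq1 (s m : int) : (s * m = 1)%R -> s = 1%R \/ s = (-1)%R.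
Proof.
move=> /(congr1 absz); rewrite abszM => /eqP.
by rewrite muln_eq1 => /andP[/eqP s1 _]; lia.
Qed.

Section AutShape.
Variables (n : nat) (k l : int).
Local Notation K := (hz n k l).
Local Notation x := (gen_x n k l).
Local Notation y := (gen_y n k l).
Local Notation z := (gen_z n k l).
Local Notation t := (gen_t n k l).

(** The last two equations are the [z]-coordinates of the relations for [t x] and [t y]; the
    determinant condition is the relation between [y] and [x]. *)
Lemma hz_aut_exists (a b c d p q e f delta : int) :
  delta = (-1)%R -> (a * d - b * c = delta)%R ->
  (2 * p + k * a + l * c + n%:Z * (e * c - f * a) - n%:Z * a * c =
    delta * k)%R ->
  (2 * q + k * b + l * d + n%:Z * (e * d - f * b) - n%:Z * b * d =
    delta * l)%R ->
  exists phi : aut K, [/\ phi x = (a, c, p, 0)%R, phi y = (b, d, q, 0)%R,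
      phi z = (0, 0, delta, 0)%R & phi t = (e, f, 0, -1)%R].
Proof.
move=> deltaN1 detE eq1 eq2.
pose X : K := (a, c, p, 0)%R; pose Y : K := (b, d, q, 0)%R.
pose Z : K := center n k l delta; pose T : K := (e, f, 0, -1)%R.
have ZE i : gexpz Z i = center n k l (delta * i).
  by rewrite /Z /center -gexpz_z -gexpzM gexpz_z.
have invE u v w : ((u, v, w, 0)%R : K)^-1 = (- u, - v, n%:Z * u * v - w, 0)%R.
  by hz_ring.
pose F := @normal_form n k l K X Y Z T.
have FM : {morph F : g h / g * h}.
  apply: normal_formM; try exact: centerC.
  - rewrite ZE !hz_mulE /psign /parity /=; congr (_, _, _, _)%R; try ring.
    by rewrite -detE; ring.
  - rewrite ZE invE !hz_mulE /psign /parity /=; congr (_, _, _, _)%R; try ring.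
    lia.
  rewrite ZE invE !hz_mulE /psign /parity /=; congr (_, _, _, _)%R; try ring.
  lia.
have [Fx Fy Fz Ft] : [/\ F x = X, F y = Y, F z = Z & F t = T].
  by split; rewrite /F /normal_form /= ?gexpz0 ?gexpz1 ?mul1g ?mulg1.
have F_vec u v w m : exists w', F (u, v, w, m) =
    (a * u + b * v + parity m * e, c * u + d * v + parity m * f, w', -1 * m)%R.
  exact: vec_normal_form.
have F_center i : F (center n k l i) = center n k l (delta * i).
  by rewrite /F /normal_form /= mulg1 !mul1g ZE.
have F_inj g h : F g = F h -> g = h.
  suff F1 w : F w = 1 -> w = 1.
    move=> Fgh; apply: (@mulIg _ h^-1); rewrite mulgV.
    by apply: F1; rewrite FM Fgh -FM mulgV morph1.
  move: w => [[[u v] w] m]; have [w' FE] := F_vec u v w m.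
  move=> Fw; move: (Fw); rewrite FE => /(congr1 (@vec n k l))/vec_inj[E1 E2 E3].
  have m0 : m = 0%R by lia.
  move: E1 E2; rewrite m0 /parity /= => E1 E2.
  have [u0 v0] : u = 0%R /\ v = 0%R.
    by apply: (@det_neq0_kernel a b c d); lia.
  move: Fw; rewrite m0 u0 v0 -/(center n k l w) F_center.
  by move=> /(congr1 (fun g : K => g.1.2)) /= w0; congr (_, _, _, _)%R; lia.
have F_surj h : exists g, F g = h.
  move: h => [[[u v] w] m].
  pose u' := (u - parity m * e)%R; pose v' := (v - parity m * f)%R.
  (* Cramer's rule with determinant [-1], after removing from [(u, v)] the contribution of the power
     of [t]. *)
  have [w' FE] := F_vec (b * v' - d * u')%R (c * u' - a * v')%R 0%R (- m)%R.
  have [|i iE] := @vecP n k l (u, v, w, m) (u, v, w', m) => //.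
  exists (center n k l (- i) *
    ((b * v' - d * u', c * u' - a * v', 0, - m)%R : K)).
  rewrite FM F_center FE iE; congr (center _ _ _ _ * _); first by lia.
  rewrite parityN; congr (_, _, _, _)%R; last by ring.
    transitivity (- (a * d - b * c) * u' + parity m * e)%R; first by ring.
    by rewrite detE deltaN1 /u'; ring.
  transitivity (- (a * d - b * c) * v' + parity m * f)%R; first by ring.
  by rewrite detE deltaN1 /v'; ring.
have [phi phiE] := aut_of FM F_inj F_surj.
by exists phi; rewrite !phiE.
Qed.

Hypothesis n_gt0 : (0 < n)%N.

Definition deg (g : K) : int := g.2.

Lemma degM g h : deg (g * h) = (deg g + deg h)%R.
Proof. by move: g h => [[[? ?] ?] ?] [[[? ?] ?] ?]. Qed.

Lemma deg_gexpz g i : deg (gexpz g i) = (i * deg g)%R.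
Proof.
move: i; apply: int_step_ind => [|i]; first by rewrite GRing.mul0r.
by rewrite gexpzS degM; split; lia.
Qed.

Lemma degV g : deg g^-1 = (- deg g)%R.
Proof. by rewrite -[g^-1]/(gexpz g (-1)) deg_gexpz GRing.mulN1r. Qed.

(** The restriction on the degree matters: [t^2] is central as well, since [psi^2 = 1]. In degree 0,
    commuting with [x] and [y] kills both other exponents because [n > 0]. *)
Lemma central_deg0 g : (forall h, commute g h) -> deg g = 0%R ->
  exists i, g = center n k l i.
Proof.
move: g => [[[a b] c] m] gC /= m0; rewrite /deg /= in m0.
have := congr1 (fun g : K => g.1.2) (gC x).
have := congr1 (fun g : K => g.1.2) (gC y).
rewrite !hz_mulE m0 /psign /parity /= => E1 E2.
by exists c; congr (_, _, _, _)%R; nia.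
Qed.

(** Applying the homomorphism [deg] to the images of the relations puts the images of [z], [x] and
    [y] in degree 0. The inverse automorphism makes [s] and [delta] units; the equations compare
    [z]-coordinates in the three relations, with a factor [n] cancelled in the first. *)
Lemma hz_aut_shape (phi : aut K) : exists a b c d p q e f r s delta : int,
  [/\ phi x = (a, c, p, 0)%R, phi y = (b, d, q, 0)%R,
      phi z = (0, 0, delta, 0)%R & phi t = (e, f, r, s)] /\
  [/\ s = 1%R \/ s = (-1)%R, delta = 1%R \/ delta = (-1)%R,
      delta = (a * d - b * c)%R,
      (2 * p + k * a + l * c + n%:Z * (e * c - f * a) - n%:Z * a * c =
    delta * k)%R &
      (2 * q + k * b + l * d + n%:Z * (e * d - f * b) - n%:Z * b * d =
    delta * l)%R].
Proof.
have phiM := @autM _ phi.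
have phiX g i : phi (gexpz g i) = gexpz (phi g) i by apply: gexpz_morph.
have Ryx : phi y * phi x = phi x * phi y * gexpz (phi z) n.
  by rewrite -phiX -!phiM gen_yx.
have Rtx : phi t * phi x = (phi x)^-1 * gexpz (phi z) k * phi t.
  by rewrite -phiX -(morphV _ phiM) -!phiM gen_tx.
have Rty : phi t * phi y = (phi y)^-1 * gexpz (phi z) l * phi t.
  by rewrite -phiX -(morphV _ phiM) -!phiM gen_ty.
have dz : deg (phi z) = 0%R.
  by move: (congr1 deg Ryx); rewrite !degM deg_gexpz; nia.
have dx : deg (phi x) = 0%R.
  by move: (congr1 deg Rtx); rewrite !degM degV deg_gexpz dz; lia.
have dy : deg (phi y) = 0%R.
  by move: (congr1 deg Rty); rewrite !degM degV deg_gexpz dz; lia.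
have dphi g : deg (phi g) = (deg (phi t) * deg g)%R.
  rewrite (hz_hom_normal_form _ phiM); move: g => [[[a b] c] m].
  by rewrite /normal_form !degM !deg_gexpz dx dy dz /deg /=; ring.
have s1 : deg (phi t) = 1%R \/ deg (phi t) = (-1)%R.
  by apply: (@int_mul_eq1 _ (deg (aut_inv phi t))); rewrite -dphi aut_invK.
have zC h : commute z h.
  have -> : z = center n k l 1 by [].
  exact: centerC.
have [delta zE] : exists i, phi z = center n k l i.
  apply: central_deg0 dz => h.
  by rewrite /commute -(aut_invK phi h) -!phiM zC.
have [delta' zE'] : exists i, aut_inv phi z = center n k l i.
  apply: central_deg0 => [h|].
    by apply: (can_inj (aut_funK phi)); rewrite !phiM aut_invK zC.
  move: (dphi (aut_inv phi z)); rewrite aut_invK.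
  by case: s1 => ->; rewrite /deg /=; lia.
have delta1 : delta = 1%R \/ delta = (-1)%R.
  apply: (@int_mul_eq1 _ delta').
  have := aut_invK phi z; rewrite zE' /center -gexpz_z phiX zE /center.
  by rewrite -gexpz_z -gexpzM gexpz_z => -[].
move: Ryx Rtx Rty dx dy s1; rewrite zE /center -gexpz_z -!gexpzM !gexpz_z.
case: (phi x) => [[[a c] p] mx]; case: (phi y) => [[[b d] q] my].
case: (phi t) => [[[e f] r] s] Ryx Rtx Rty; rewrite /deg /= => mx0 my0 s1.
exists a, b, c, d, p, q, e, f, r, s, delta.
have sE : psign s = (-1)%R /\ parity s = 1%R by case: s1 => ->.
have invE u v w : ((u, v, w, 0)%R : K)^-1 = (- u, - v, n%:Z * u * v - w, 0)%R.
  by hz_ring.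
move: Ryx Rtx Rty; rewrite mx0 my0 !invE => Ryx Rtx Rty.
split=> //; split=> //.
- move: (congr1 (fun g : K => g.1.2) Ryx); rewrite !hz_mulE.
  by rewrite /psign /parity /=; nia.
- move: (congr1 (fun g : K => g.1.2) Rtx); rewrite !hz_mulE !sE.1 !sE.2.
  by rewrite /psign /parity /=; lia.
move: (congr1 (fun g : K => g.1.2) Rty); rewrite !hz_mulE !sE.1 !sE.2.
by rewrite /psign /parity /=; lia.
Qed.

End AutShape.

(** * The spectrum, with explicit matrices *)

Section Spectrum.
Local Open Scope classical_set_scope.
Variables (n : nat) (k l : int).
Hypothesis n_gt0 : (0 < n)%N.
Local Notation spectrum := (reidemeister_spectrum (hz n k l)).

(* Solvability of the relations of [E] for [x |-> x^a y^c z^p],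
   [y |-> x^b y^d z^q], [z |-> z^-1] and [t |-> x^e y^f t^-1]. Modulo 2 they say
   that [(k, l)] is fixed by the matrix when [n] is even, and they can always be
   solved for [e, f] when [n] is odd. *)
Definition aut_data (a b c d p q e f : int) : Prop :=
  [/\ (a * d - b * c = -1)%R,
      (2 * p + k * a + l * c + n%:Z * (e * c - f * a) - n%:Z * a * c = - k)%R &
      (2 * q + k * b + l * d + n%:Z * (e * d - f * b) - n%:Z * b * d = - l)%R].

Lemma spectrum_trace r : spectrum r ->
  r = None \/ exists a b c d p q e f, [/\ aut_data a b c d p q e f,
    (a + d != 0)%R & r = Some (4 * `|(a + d)%R|)%N].
Proof.
move=> [phi _ <-].
have [a [b [c [d [p [q [e [f [r0 [s [delta]]]]]]]]]]] := hz_aut_shape n_gt0 phi.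
move=> [[phix phiy phiz phit] [s1 delta1 detE eq1 eq2]].
have s_odd : oddz s by case: s1 => ->.
case: s1 => sE.
  by left; apply: (reidemeister_pos phix phiy phiz phit s_odd sE).
have [D0|D0] := eqVneq ((1 - a) * (1 - d) - b * c)%R 0%R.
  by left; apply: (reidemeister_singular phix phiy phiz phit s_odd sE D0).
case: delta1 => deltaE.
  by left; apply: (reidemeister_central phix phiy phiz phit s_odd sE D0 deltaE).
have tr0 : (a + d != 0)%R by lia.
right; exists a, b, c, d, p, q, e, f; split=> //.
  by split; [lia|rewrite eq1 deltaE; ring|rewrite eq2 deltaE; ring].
by apply: (reidemeister_finite phix phiy phiz phit s_odd sE deltaE _ tr0); lia.
Qed.

Lemma trace_spectrum (a b c d p q e f : int) : aut_data a b c d p q e f ->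
  spectrum (if (a + d == 0)%R then None else Some (4 * `|(a + d)%R|)%N).
Proof.
move=> [detE eq1 eq2].
have [||phi [phix phiy phiz phit]] :=
    @hz_aut_exists n k l a b c d p q e f (-1)%R (erefl _) detE.
- by rewrite eq1 GRing.mulN1r.
- by rewrite eq2 GRing.mulN1r.
exists phi => //; have s_odd : oddz (-1) by [].
have [tr0|tr0] := eqVneq (a + d)%R 0%R; last first.
  exact: (reidemeister_finite phix phiy phiz phit s_odd (erefl _) (erefl _)
    detE tr0).
by apply: (reidemeister_singular phix phiy phiz phit s_odd (erefl _) _); lia.
Qed.

(** The case [m = 0] is included because trace 0 realizes the value infinity. *)
Lemma spectrum_multiples4 : (forall m : nat, exists a b c d p q e f,
    aut_data a b c d p q e f /\ (a + d = m%:Z)%R) ->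
  spectrum = multiples_oo 4.
Proof.
move=> ex; apply/seteqP; split=> r.
  move=> /spectrum_trace[->|[a [b [c [d [_ [_ [_ [_ [_ tr0 ->]]]]]]]]]].
    by right.
  by left; exists `|(a + d)%R|%N => //=; lia.
have tr m : spectrum (if m == 0%N then None else Some (4 * m)%N).
  have [a [b [c [d [p [q [e [f [/trace_spectrum]]]]]]]]] := ex m.
  by move=> + trE; rewrite trE.
case=> [[m /= m_gt0 <-]|->]; last exact: tr 0%N.
by have := tr m; case: m m_gt0.
Qed.

(* Modulo 2 the matrix has determinant 1 and fixes [(k, l) <> 0], so that its
   trace is even. *)
Lemma spectrum_multiples8 : ~~ odd n -> oddz k || oddz l ->
  (forall m : nat, exists a b c d p q e f,
    aut_data a b c d p q e f /\ (a + d = 2 * m%:Z)%R) ->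
  spectrum = multiples_oo 8.
Proof.
move=> n_even kl_odd ex; apply/seteqP; split=> r.
  move=> /spectrum_trace[->|]; first by right.
  move=> [a [b [c [d [p [q [e [f [[detE eq1 eq2] tr0 ->]]]]]]]]].
  have tr_even : ~~ oddz (a + d).
    move: (congr1 oddz detE) (congr1 oddz eq1) (congr1 oddz eq2) kl_odd.
    rewrite !(oddzD, oddzN, oddzM) (_ : oddz n = odd n) // (negbTE n_even) /=.
    by case: (oddz a); case: (oddz b); case: (oddz c); case: (oddz d);
      case: (oddz k); case: (oddz l) => /=; rewrite ?addbF ?andbF.
  by left; exists (`|(a + d)%R| %/ 2)%N => /=; move: tr0 tr_even; rewrite /oddz;
    [|move=> *; congr Some]; lia.
have tr m : spectrum (if m == 0%N then None else Some (8 * m)%N).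
  have [a [b [c [d [p [q [e [f [/trace_spectrum]]]]]]]]] := ex m.
  move=> + trE; rewrite trE; case: m {trE} => // m.
  by congr (spectrum (Some _)); lia.
case=> [[m /= m_gt0 <-]|->]; last exact: tr 0%N.
by have := tr m; case: m m_gt0.
Qed.

(** With [e] and [f] so chosen, the equations become [2 p = - (n + 1) e] and [2 q = (n - 1) s],
    solvable because [n] is odd. *)
Lemma aut_data_n_odd : odd n -> forall m : nat, exists a b c d p q e f,
  aut_data a b c d p q e f /\ (a + d = m%:Z)%R.
Proof.
move=> n_odd m; pose h := (n./2)%:Z%R.
have nE : (n%:Z = 2 * h + 1)%R by rewrite /h; lia.
pose s := (k + l * m%:Z + l)%R; pose e := (k + l)%R.
exists 0%R, 1%R, 1%R, m%:Z%R, (- (h + 1) * e)%R, (h * s)%R, e,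
  (s + e * m%:Z - m%:Z)%R.
by split; [split|]; rewrite ?nE /s /e; ring.
Qed.

Lemma aut_data_even : ~~ odd n -> ~~ oddz k -> ~~ oddz l ->
  forall m : nat, exists a b c d p q e f,
  aut_data a b c d p q e f /\ (a + d = m%:Z)%R.
Proof.
move=> n_even k_even l_even m; pose h := (n./2)%:Z%R.
have nE : (n%:Z = 2 * h)%R by rewrite /h; lia.
have := half_parity k; have := half_parity l.
rewrite /parity (negbTE k_even) (negbTE l_even) /=.
set k' := (k %/ 2)%Z; set l' := (l %/ 2)%Z => lE kE.
exists 0%R, 1%R, 1%R, m%:Z%R, (- (k' + l'))%R,
  (- k' - l' * m%:Z - l' + h * m%:Z)%R, 0%R, 0%R.
by split; [split|]; rewrite ?nE ?kE ?lE; ring.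
Qed.

(** One matrix of determinant [-1] and trace [2 m] for each nonzero class of [(k, l)] modulo 2,
    fixing that row vector: modulo 2, the swap fixes [(1, 1)], a lower unipotent matrix [(1, 0)] and
    an upper one [(0, 1)]. *)
Lemma aut_data_kl_odd : ~~ odd n -> oddz k || oddz l ->
  forall m : nat, exists a b c d p q e f,
  aut_data a b c d p q e f /\ (a + d = 2 * m%:Z)%R.
Proof.
move=> n_even kl_odd m; pose h := (n./2)%:Z%R; pose M := m%:Z%R.
have nE : (n%:Z = 2 * h)%R by rewrite /h; lia.
have := half_parity k; have := half_parity l; move: kl_odd; rewrite /parity.
set k' := (k %/ 2)%Z; set l' := (l %/ 2)%Z.
case: (oddz k); case: (oddz l) => //= _ lE kE.
- exists 0%R, 1%R, 1%R, (2 * M)%R, (- (k' + l' + 1))%R,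
    (- (k' + l' + 1) - l * M + n%:Z * M)%R, 0%R, 0%R.
  by split; [split|]; rewrite ?nE ?kE ?lE; ring.
- exists 1%R, 2%:Z%R, M, (2 * M - 1)%R, (- k - l' * M + h * M)%R,
    (- k - l * M + n%:Z * (2 * M - 1))%R, 0%R, 0%R.
  by split; [split|]; rewrite ?nE ?kE ?lE; ring.
exists (2 * M - 1)%R, M, 2%:Z%R, 1%R,
  (- k * M - l + n%:Z * (2 * M - 1))%R, (- k' * M - l + h * M)%R, 0%R, 0%R.
by split; [split|]; rewrite ?nE ?kE ?lE; ring.
Qed.

End Spectrum.

Local Open Scope classical_set_scope.

Theorem proposition5p23 (n : nat) (k l : int) (psi : aut (heis n)) :
  (0 < n)%N ->
  psi (heis_x n) = (heis_x n)^-1 * gexpz (heis_z n) k ->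
  psi (heis_y n) = (heis_y n)^-1 * gexpz (heis_z n) l ->
  (odd n -> reidemeister_spectrum (sdprodZ psi) = multiples_oo 4) /\
  (~~ odd n ->
    ((2 %| k)%Z /\ (2 %| l)%Z ->
      reidemeister_spectrum (sdprodZ psi) = multiples_oo 4) /\
    (~~ (2 %| k)%Z \/ ~~ (2 %| l)%Z ->
      reidemeister_spectrum (sdprodZ psi) = multiples_oo 8)).
Proof.
move=> n_gt0 psix psiy.
have [rho rhoM rho_bij] := sdprodZ_heis_iso n_gt0 psix psiy.
rewrite (reidemeister_spectrum_iso rhoM rho_bij).
have oddzE i : oddz i = ~~ (2 %| i)%Z by rewrite /oddz; lia.
split=> [n_odd|n_even].
  exact/spectrum_multiples4/aut_data_n_odd.
split=> [[k_even l_even]|kl_odd].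
  by apply/spectrum_multiples4/aut_data_even; rewrite ?oddzE ?negbK.
have {}kl_odd : oddz k || oddz l by rewrite !oddzE; apply/orP.
exact/spectrum_multiples8/aut_data_kl_odd.
Qed.
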